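(* Let $S$ be a cancellative semigroup of rational maps. Then $S$ is embeddable into a group whenever one of the following conditions holds. (1) $S$ is isomorphic to a subsemigroup of $MP$. (2) $S\simeq\langle R,Q\rangle$, where $R,Q$ are non-injective rational maps sharing a common superattracting fixed point. (3) $S$ is isomorphic to the free product of right amenable subsemigroups.
   Context: A semigroup of rational maps is a non-empty family of rational maps (holomorphic self-maps of $\overline{\mathbb{C}}$) closed under composition, with composition as product; $\langle R,Q\rangle$ denotes the semigroup generated by $R$ and $Q$. Non-injective rational maps are the rational maps of degree at least $2$. Isomorphisms are isomorphisms of abstract semigroups. $MP$ is the semigroup of monomials $\lambda z^n$ with $\lambda\in\mathbb{C}\setminus\{0\}$ and $n\ge1$, under composition. A semigroup is cancellative if each of $ab=ac$ and $ba=ca$ implies $b=c$. A semigroup $T$ is right amenable if there is a mean $M$ (positive continuous linear functional with $M(1)=1$) on the space $L_\infty(T)$ of bounded complex functions on $T$ such that $M(r_s\phi)=M(\phi)$ for all $s\in T$, $\phi\in L_\infty(T)$, where $(r_s\phi)(t)=\phi(ts)$. A semigroup is embeddable into a group if there is an injective semigroup homomorphism from it into some group. *)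

(* Defs.v *)
From HB Require Import structures.
From mathcomp Require Import all_boot all_order all_algebra.
From mathcomp Require Import all_classical all_reals all_analysis.
From mathcomp Require Import complex.

Set Implicit Arguments.
Unset Strict Implicit.
Unset Printing Implicit Defensive.

Import Order.TTheory GRing.Theory Num.Theory.
Import numFieldNormedType.Exports.

Local Open Scope classical_set_scope.
Local Open Scope ring_scope.
Local Open Scope complex_scope.

Record subsemigroup (T : semigroupType) := Subsemigroup {
  subsemigroup_set :> set T;
  subsemigroup_neq0 : subsemigroup_set !=set0;
  subsemigroup_mul : forall x y : T,
    subsemigroup_set x -> subsemigroup_set y -> subsemigroup_set (x * y)%g }.

Definition subsemigroup_sort (T : semigroupType) (A : subsemigroup T) : Type :=
  set_type A.

Section SubsemigroupSort.
Variables (T : semigroupType) (A : subsemigroup T).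

HB.instance Definition _ := [isSub of subsemigroup_sort A for
  (fun x : subsemigroup_sort A => sval x)].
HB.instance Definition _ := [Choice of subsemigroup_sort A by <:].

Let mulg_closedA : mulg_closed [pred x : T | x \in (A : set T)].
Proof.
by move=> x y /set_mem Ax /set_mem Ay; apply/mem_set/subsemigroup_mul.
Qed.

HB.instance Definition _ := SubChoice_isSubSemigroup.Build T
  [pred x : T | x \in (A : set T)] (subsemigroup_sort A) mulg_closedA.
End SubsemigroupSort.

Coercion subsemigroup_semigroup (T : semigroupType) (A : subsemigroup T) :
  semigroupType := subsemigroup_sort A.

Section Generated.
Variables (T : semigroupType) (x y : T).

Definition generated2_set : set T :=
  smallest (fun A : set T => forall a b, A a -> A b -> A (a * b)%g)
    [set x; y].

Let generated2_neq0 : generated2_set !=set0.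
Proof. by exists x => A [_]; apply; left. Qed.

Let generated2_mul a b :
  generated2_set a -> generated2_set b -> generated2_set (a * b)%g.
Proof. by move=> ha hb A AP; apply: (AP.1); [exact: ha|exact: hb]. Qed.

Definition generated2 : subsemigroup T :=
  Subsemigroup generated2_neq0 generated2_mul.
End Generated.

Definition cancellative (S : semigroupType) : Prop :=
  forall a b c : S,
    ((a * b = a * c)%g -> b = c) /\ ((b * a = c * a)%g -> b = c).

Definition isomorphic (S T : semigroupType) : Prop :=
  exists f : {multiplicative S -> T}, bijective f.

Definition embeddable_in_group (S : semigroupType) : Prop :=
  exists (G : groupType) (f : {multiplicative S -> G}), injective f.

(* The free product of the semigroups A i: non-empty words whose adjacent     *)
(* letters come from different factors; the product of two words is their     *)
(* concatenation, in which adjacent letters of a same factor get multiplied.  *)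
Section FreeProduct.
Variables (I : choiceType) (A : I -> semigroupType).
Local Notation letter := {i : I & A i}.
Implicit Types (x y : letter) (u v w : seq letter).

Definition reduced w : bool :=
  (w != [::]) && sorted (fun x y => tag x != tag y) w.

Definition reduce_cons x w : seq letter :=
  if w is y :: w' then
    if tag x == tag y then
      Tagged (fun i => A i) (tagged x * tagged_as x y)%g :: w'
    else x :: w
  else [:: x].

Definition reduce w : seq letter := foldr reduce_cons [::] w.

Let reduce_consM i (a b : A i) w :
  reduce_cons (Tagged (fun i => A i) (a * b)%g) w =
  reduce_cons (Tagged (fun i => A i) a)
    (reduce_cons (Tagged (fun i => A i) b) w).
Proof.
case: w => [|[j c] w] /=; first by rewrite eqxx tagged_asE.
case: eqP => [ij|_] /=; last by rewrite eqxx tagged_asE.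
by subst j; rewrite eqxx !tagged_asE /= mulgA.
Qed.

Let reduce_cons_cat x w v :
  reduce (reduce_cons x w ++ v) = reduce_cons x (reduce (w ++ v)).
Proof.
case: x => i a; case: w => [//|[j b] w] /=.
case: eqP => [ij|//] /=; subst j; rewrite tagged_asE.
exact: reduce_consM.
Qed.

Let reduce_catl u v : reduce (reduce u ++ v) = reduce (u ++ v).
Proof. by elim: u => //= x u IH; rewrite reduce_cons_cat IH. Qed.

Let reduce_id w : sorted (fun x y => tag x != tag y) w -> reduce w = w.
Proof.
elim: w => //= x w IH xw; rewrite IH ?(path_sorted xw) //.
by case: w xw {IH} => //= y w /andP[/negbTE ->].
Qed.

Let reduce_cons_sorted x w : sorted (fun x y => tag x != tag y) w ->
  sorted (fun x y => tag x != tag y) (reduce_cons x w).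
Proof.
case: w => //= y w yw; case: eqP => [xy|/eqP xy] /=; last by rewrite xy.
by case: w yw => //= z w; rewrite xy.
Qed.

Let reduce_sorted w : sorted (fun x y => tag x != tag y) (reduce w).
Proof. by elim: w => //= x w IH; apply: reduce_cons_sorted. Qed.

Let reduce_catr u v : reduce (u ++ reduce v) = reduce (u ++ v).
Proof. by elim: u => [|x u /= ->//]; rewrite /= reduce_id. Qed.

Let reduce_reduced w : w != [::] -> reduced (reduce w).
Proof.
move=> w0; rewrite /reduced reduce_sorted andbT.
by case: w w0 => //= x w _; case: (reduce w) => //= y s; case: ifP.
Qed.

Record free_product := FreeProduct {
  free_word :> seq letter;
  free_wordP : reduced free_word }.

HB.instance Definition _ := [isSub for free_word].
HB.instance Definition _ := [Choice of free_product by <:].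

Let free_mul_subproof (u v : free_product) :
  reduced (reduce (free_word u ++ free_word v)).
Proof.
by apply: reduce_reduced; case: u => -[].
Qed.

Definition free_mul (u v : free_product) : free_product :=
  FreeProduct (free_mul_subproof u v).

Let free_mulA : associative free_mul.
Proof.
by move=> u v w; apply: val_inj; rewrite /= reduce_catr reduce_catl catA.
Qed.

HB.instance Definition _ := isSemigroup.Build free_product free_mulA.
End FreeProduct.

Section Amenability.
Variables (R : realType) (T : semigroupType).
Local Notation C := R[i].

Definition Linfty : set {uniform T -> C^o} :=
  [set phi | [bounded phi t | t in [set: T]]].

(* M is a functional on Linfty: its values elsewhere are irrelevant. The      *)
(* topology of {uniform T -> C^o} induces on Linfty that of the sup norm.     *)
Record is_mean (M : {uniform T -> C^o} -> C^o) : Prop := IsMean {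
  mean_linear : forall (a : C) (phi psi : {uniform T -> C^o}),
    Linfty phi -> Linfty psi ->
    M (fun t => a * phi t + psi t) = a * M phi + M psi;
  mean_ge0 : forall phi : {uniform T -> C^o},
    Linfty phi -> (forall t, 0 <= phi t) -> 0 <= M phi;
  mean_continuous : {within Linfty, continuous M};
  mean1 : M (fun=> 1) = 1 }.

Definition right_amenable : Prop :=
  exists2 M : {uniform T -> C^o} -> C^o, is_mean M &
    forall (s : T) (phi : {uniform T -> C^o}), Linfty phi ->
      M (fun t => phi (t * s)%g) = M phi.
End Amenability.

Definition selfmap (X : Type) : Type := X -> X.

Section SelfmapSemigroup.
Variable X : Type.
HB.instance Definition _ := gen_eqMixin (selfmap X).
HB.instance Definition _ := gen_choiceMixin (selfmap X).

Definition selfmap_mul (f g : selfmap X) : selfmap X := f \o g.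

Let selfmap_mulA : associative selfmap_mul. Proof. by []. Qed.
HB.instance Definition _ := isSemigroup.Build (selfmap X) selfmap_mulA.
End SelfmapSemigroup.

Section RationalMaps.
Variable R : realType.
Local Notation C := R[i].

(* The Riemann sphere: Some z is the point z of C, None is infinity. *)
Definition Cbar : Type := one_point_compactification C.

Definition fraction_degree (p q : {poly C}) : nat :=
  (maxn (size p) (size q)).-1.

(* The map p / q, for coprime p and q. *)
Definition fraction_map (p q : {poly C}) : selfmap Cbar := fun w =>
  match w with
  | Some z => if q.[z] == 0 then None else Some (p.[z] / q.[z])
  | None => let d := fraction_degree p q in
      if q`_d == 0 then None else Some (p`_d / q`_d)
  end.

Definition rational_map_of_degree (d : nat) (f : selfmap Cbar) : Prop :=
  exists p q : {poly C},
    [/\ coprimep p q, fraction_degree p q = d & f = fraction_map p q].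

Definition rational_map : set (selfmap Cbar) :=
  [set f | exists d, rational_map_of_degree d f].

(* Rational maps of degree at least 2; in particular, not the constant ones. *)
Definition noninjective_rational_map : set (selfmap Cbar) :=
  [set f | exists2 d, (2 <= d)%N & rational_map_of_degree d f].

Definition inv_Cbar : selfmap Cbar := fun w =>
  match w with
  | Some z => if z == 0 then None else Some z^-1
  | None => Some 0
  end.

(* f read in the coordinate z if w is finite and 1 / z if w is infinity; the  *)
(* value 0 at poles is irrelevant for the derivative at a fixed point.        *)
Definition local_map (f : selfmap Cbar) (w : Cbar) : C^o -> C^o := fun z =>
  odflt 0 (if w is Some _ then f (Some z)
           else inv_Cbar (f (inv_Cbar (Some z)))).

Definition superattracting_fixed_point (f : selfmap Cbar) (w : Cbar) : Prop :=
  f w = w /\ is_derive (odflt 0 w : C^o) (1 : C^o) (local_map f w) 0.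

Definition monomial_map (l : C) (n : nat) : selfmap Cbar :=
  omap (fun z => l * z ^+ n).

Definition MP_set : set (selfmap Cbar) :=
  [set f | exists (l : C) (n : nat),
     [/\ l != 0, (1 <= n)%N & f = monomial_map l n]].

Let MP_neq0 : MP_set !=set0.
Proof. by exists (monomial_map 1 1), 1, 1%N; rewrite oner_neq0. Qed.

Let MP_mul f g : MP_set f -> MP_set g -> MP_set (f * g)%g.
Proof.
move=> [l [n [l0 n0 ->]]] [m [k [m0 k0 ->]]].
exists (l * m ^+ n), (k * n)%N; split.
- by rewrite mulf_neq0 // expf_neq0.
- by rewrite muln_gt0 n0 k0.
- by apply/funext => -[z|//]; congr Some; rewrite exprMn mulrA exprM.
Qed.

Definition MP : subsemigroup (selfmap Cbar) := Subsemigroup MP_neq0 MP_mul.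
End RationalMaps.

(* Main.v *)
Require Import Defs.
From HB Require Import structures.
From mathcomp Require Import all_boot all_order all_algebra.
From mathcomp Require Import all_classical all_reals all_analysis.
From mathcomp Require Import complex ring.

(** In each case the semigroup is shown to act faithfully by bijections on
    some set, so that it embeds in the group of bijections of this set.

    Monomials. A semigroup of monomials [l * z ^ n] acts on the complex
    numbers by surjective maps. They become injective once two points [x] and
    [y] are identified whenever [x ^ d = y ^ d] for some degree [d] of the
    semigroup. Two monomials that act in the same way on the quotient have the
    same degree, and coefficients with the same power of exponent [d], where
    [d] is the degree of some member [u]; then [u] has the same product with
    both, and they are equal by cancellation ([embeddable_monomials]).

    Common superattracting fixed point. If distinct words in [P] and [Q] are
    distinct maps, the semigroup is free and acts on the rationals by affine
    maps ([embeddable_free2]). Otherwise a relation can be cancelled on the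
    right until it reads [A o Q = B o P]. Take the fixed point as origin and a
    Boettcher coordinate of [P], in which [P] is [z ^ n]. If [Q] were not a
    monomial in this coordinate, but [b * z ^ m * (1 + t * z ^ k + ...)] with
    [t != 0], then [A o Q] would deviate from a monomial at the relative order
    [k] exactly, whereas [B o P] would do so at an order at least [2 * k]:
    precomposition by [P] multiplies the orders by [n >= 2]. Hence [Q] is a
    monomial too, words in [P] and [Q] are determined by their leading terms
    at the origin, and leading terms reduce the question to semigroups of
    monomials.

    The Boettcher coordinate itself is a power series, but its power of
    exponent [n ^ N] is approximated, up to the relative order [n ^ N], by the
    iterate [P ^ N], which is a rational map. The argument is carried out with
    these iterates, in the local ring of rational functions at the origin
    ([relation_proportional], [leading_determines_word]). The identity theorem
    ([projective_near_eq]) goes back from germs to maps of the sphere.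

    Free products. In a right amenable semigroup two left ideals [T * s] and
    [T * t] meet, because the mean of the indicator of each of them is 1
    ([right_amenable_common_multiple]); with cancellation this is Ore's
    condition, and each factor embeds in a group of fractions
    ([embeddable_common_multiple]). The free product of these groups is
    replaced by its action on normal forms ([embeddable_free_product]). *)

Set Implicit Arguments.
Unset Strict Implicit.
Unset Printing Implicit Defensive.

Import Order.TTheory GRing.Theory Num.Theory.
Import numFieldNormedType.Exports.

Local Open Scope classical_set_scope.

(** * Semigroups acting by bijections *)

Record bijection (X : Type) := Bijection {
  bijection_fun :> X -> X;
  bijection_inv : X -> X;
  bijection_funK : cancel bijection_fun bijection_inv;
  bijection_invK : cancel bijection_inv bijection_fun }.

Section BijectionGroup.
Variable X : Type.
Implicit Types f g h : bijection X.

HB.instance Definition _ := gen_eqMixin (bijection X).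
HB.instance Definition _ := gen_choiceMixin (bijection X).

Lemma bijection_ext f g : f =1 g -> f = g.
Proof.
case: f g => [f f' fK f'K] [g g' gK g'K] /= /funext fg; subst g.
have f'g' : f' = g' by apply/funext => x; rewrite -[x in RHS]f'K gK.
by subst g'; congr Bijection; exact: Prop_irrelevance.
Qed.

Definition bijection_one : bijection X :=
  @Bijection X id id (fun=> erefl) (fun=> erefl).

Definition bijection_mul f g : bijection X :=
  Bijection (can_comp (bijection_funK f) (bijection_funK g))
            (can_comp (bijection_invK g) (bijection_invK f)).

Definition bijection_opp f : bijection X :=
  Bijection (bijection_invK f) (bijection_funK f).

Let mulA : associative bijection_mul.
Proof. by move=> f g h; apply: bijection_ext. Qed.
Let mul1 : left_id bijection_one bijection_mul.
Proof. by move=> f; apply: bijection_ext. Qed.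
Let mulr1 : right_id bijection_one bijection_mul.
Proof. by move=> f; apply: bijection_ext. Qed.
Let mulV : left_inverse bijection_one bijection_opp bijection_mul.
Proof. by move=> f; apply: bijection_ext => x; exact: bijection_funK. Qed.
Let mulrV : right_inverse bijection_one bijection_opp bijection_mul.
Proof. by move=> f; apply: bijection_ext => x; exact: bijection_invK. Qed.

HB.instance Definition _ :=
  isGroup.Build (bijection X) mulA mul1 mulr1 mulV mulrV.
End BijectionGroup.

Lemma multiplicative_of (S T : semigroupType) (f : S -> T) :
  {morph f : x y / (x * y)%g} ->
  exists g : {multiplicative S -> T}, g = f :> (S -> T).
Proof.
move=> fM; pose m := isMultiplicative.Build S T f fM.
by pose g : {multiplicative S -> T} := HB.pack f m; exists g.
Qed.

Lemma embeddable_of_action (S : semigroupType) (X : Type) (act : S -> X -> X) :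
    (forall s, bijective (act s)) ->
    (forall s t x, act (s * t)%g x = act s (act t x)) ->
    injective act -> embeddable_in_group S.
Proof.
move=> act_bij actM act_inj.
have actb s : exists b : bijection X, b = act s :> (X -> X).
  by have [g fK gK] := act_bij s; exists (Bijection fK gK).
have [b bE] := choice actb.
have bM : {morph b : x y / (x * y)%g}.
  by move=> s t; apply: bijection_ext => x /=; rewrite !bE actM.
have [g gE] := multiplicative_of bM.
exists (bijection X : groupType), g; rewrite gE => s t st.
by apply: act_inj; rewrite -!bE st.
Qed.

(** A right action becomes a left action by taking inverses. *)
Lemma embeddable_of_right_action (S : semigroupType) (X : Type)
    (act : X -> S -> X) :
    (forall s, bijective (act^~ s)) ->
    (forall x s t, act x (s * t)%g = act (act x s) t) ->
    injective (fun s => act^~ s) -> embeddable_in_group S.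
Proof.
move=> act_bij actM act_inj.
have actb s : exists b : X -> X, cancel (act^~ s) b /\ cancel b (act^~ s).
  by have [g fK gK] := act_bij s; exists g.
have [b /all_and2[bK Kb]] := choice actb.
have actbK s x : act (b s x) s = x := Kb s x.
apply: (@embeddable_of_action S X b) => [s|s t x|s t st].
- by exists (act^~ s); [exact: Kb|exact: bK].
- by rewrite -[RHS](bK (s * t)%g) actM !actbK.
- apply: act_inj; apply/funext => x.
  by rewrite -[LHS](actbK t) -st bK.
Qed.

Lemma embeddable_injective (S T : semigroupType) (f : S -> T) :
  {morph f : x y / (x * y)%g} -> injective f ->
  embeddable_in_group T -> embeddable_in_group S.
Proof.
move=> fM f_inj [G [g g_inj]].
have [|h hE] := @multiplicative_of S G (g \o f).
  by move=> x y /=; rewrite fM gmulfM.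
by exists G, h; rewrite hE; exact: inj_comp.
Qed.

Lemma cancellative_injective (S T : semigroupType) (f : S -> T) :
  {morph f : x y / (x * y)%g} -> injective f ->
  cancellative T -> cancellative S.
Proof.
move=> fM f_inj T_can a b c.
have [canl canr] := T_can (f a) (f b) (f c).
by split=> /(congr1 f); rewrite !fM; [move/canl|move/canr]; exact: f_inj.
Qed.

Lemma isomorphic_cancellative (S T : semigroupType) :
  isomorphic S T -> cancellative S -> cancellative T.
Proof.
move=> [f [g fK gK]]; apply: (@cancellative_injective T S g).
  exact: can2_gmulfM fK gK.
exact: can_inj gK.
Qed.

Lemma isomorphic_embeddable (S T : semigroupType) :
  isomorphic S T -> embeddable_in_group T -> embeddable_in_group S.
Proof.
move=> [f f_bij]; apply: (@embeddable_injective S T f).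
  exact: gmulfM.
exact: bij_inj.
Qed.

(** * Right amenable cancellative semigroups *)

Lemma Linfty_le (R : realType) (T : semigroupType) (t0 : T)
    (phi : {uniform T -> R[i]^o}) (M : R[i]) :
  (forall t, `|phi t| <= M)%R -> Linfty phi.
Proof.
move=> phiM; have FF := globally_properfilter (I : [set: T] t0).
by apply/ex_bound; exists M => t _; exact: phiM.
Qed.

(** If the left ideals [T * s] and [T * t] were disjoint, then the mean of both
    indicators would be that of the constant 1, since [r_s] maps the indicator
    of [T * s] to 1, whereas the sum of these indicators is at most 1. *)
Lemma right_amenable_common_multiple (R : realType) (T : semigroupType) :
  right_amenable R T -> forall s t : T, exists x y : T, (x * s = y * t)%g.
Proof.
move=> [M [Mlin Mge0 _ M1] Minv] s t; apply: contrapT => disj.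
pose ind (A : set T) : {uniform T -> R[i]^o} := fun x => (x \in A)%:R%R.
have Lind (A : set T) : Linfty (ind A).
  apply: (@Linfty_le R T s _ 1%R) => x; rewrite /ind.
  by case: (x \in A); rewrite ?normr1 // normr0 ler01.
have Lone : Linfty (fun _ : T => 1%R : R[i]^o).
  by apply: (@Linfty_le R T s _ 1%R) => x; rewrite normr1.
pose L u := [set x * u | x in [set: T]]%g.
have ML u : M (ind (L u)) = 1%R.
  rewrite -(Minv u) // -[RHS]M1; congr M; apply/funext => x.
  by rewrite /ind mem_set //; exists x.
pose h : {uniform T -> R[i]^o} := fun x => (-1 * ind (L t) x + 1)%R.
have Lh : Linfty h.
  apply: (@Linfty_le R T s _ 2%R) => x; rewrite /h /ind mulN1r.
  by case: (x \in _); rewrite ?addNr ?normr0 ?ler0n // oppr0 add0r normr1 ler1n.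
have Mh : M h = 0%R.
  rewrite /h (Mlin (-1)%R (ind (L t)) (fun=> 1%R)) // ML M1.
  by rewrite mulN1r addNr.
have : (0 <= M (fun x => -1 * ind (L s) x + h x : R[i]^o))%R.
  apply: Mge0 => [|x].
    apply: (@Linfty_le R T s _ 3%R) => x; rewrite /h /ind.
    by case: (x \in _); case: (x \in _);
      rewrite !mulN1r ?oppr0 ?add0r ?addNr ?addr0
        ?normr0 ?normrN ?normr1 ?ler0n ?ler1n.
  rewrite /h /ind.
  have [/set_mem[y _ ys]|_] := boolP (x \in L s);
    have [/set_mem[z _ zt]|_] := boolP (x \in L t);
    rewrite !mulN1r ?oppr0 ?add0r ?addNr ?addr0 ?ler01 //.
  by exfalso; apply: disj; exists y, z; rewrite ys zt.
by rewrite (Mlin (-1)%R (ind (L s)) h) // ML Mh mulN1r addr0 oppr_ge0 lt_geF.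
Qed.

(** * Bijections of a quotient *)

(** Fractions are defined up to a common factor and roots up to roots of unity:
    the maps by which a semigroup acts on them are bijective only modulo an
    equivalence [r], and become bijections of the quotient by [r]. *)
Lemma quotient_bijections (S : Type) (Y : choiceType) (r : Y -> Y -> Prop)
    (F : S -> Y -> Y) :
    (forall x, r x x) -> (forall x y, r x y -> r y x) ->
    (forall x y z, r x y -> r y z -> r x z) ->
    (forall s x y, r (F s x) (F s y) <-> r x y) ->
    (forall s y, exists x, r (F s x) y) ->
    (forall s t, (forall x, r (F s x) (F t x)) -> s = t) ->
  exists (X : Type) (act : S -> X -> X),
    [/\ forall s, bijective (act s),
        forall s t u, (forall x, r (F u x) (F s (F t x))) ->
          forall x, act u x = act s (act t x)
      & injective act].
Proof.
move=> r_refl r_sym r_trans rF F_surj F_inj.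
pose e := EquivRel (fun x y => `[< r x y >])
  (fun x => asboolT (r_refl x))
  (fun x y => asbool_equiv_eq (conj (r_sym x y) (r_sym y x)))
  (fun y x z => fun xy yz => asboolT (r_trans x y z (asboolW xy) (asboolW yz))).
pose Q := {eq_quot e}%qT.
have piE x y : (\pi_Q x = \pi_Q y)%qT <-> r x y.
  by split=> [/eqmodP/asboolW//|xy]; apply/eqmodP/asboolT.
have repr_pi x : r (repr (\pi_(Q) x)%qT) x.
  by apply/piE; rewrite reprK.
exists Q, (fun s (x : Q) => (\pi_Q (F s (repr x)))%qT); split.
- move=> s; have [b bE] := choice (F_surj s).
  exists (fun x : Q => (\pi_Q (b (repr x)))%qT) => x.
    rewrite -[RHS]reprK; apply/piE/(rF s).
    by apply: (r_trans _ _ _ (bE _)); exact: repr_pi.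
  rewrite -[RHS]reprK; apply/piE; apply: (r_trans _ _ _ _ (bE _)).
  by apply/rF; exact: repr_pi.
- move=> s t u rstu x; apply/piE; apply: (r_trans _ _ _ (rstu _)).
  by apply/rF/r_sym; exact: repr_pi.
- move=> s t st; apply: F_inj => x.
  have /piE stx := congr1 (fun f => f (\pi_Q x)%qT) st.
  have rep s' := (rF s' _ _).2 (repr_pi x).
  exact: r_trans (r_sym _ _ (rep s)) (r_trans _ _ _ stx (rep t)).
Qed.

(** * Ore's theorem *)

(** With common left multiples, fractions [x^-1 * y] make sense: here pairs
    [(x, y)] up to multiplication of both components on the left. The semigroup
    acts on them on the right, and [(x^-1 * y) * s^-1] is again a fraction
    because [y * s^-1 = u^-1 * v] as soon as [u * y = v * s]. *)
Lemma embeddable_common_multiple (T : semigroupType) :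
    cancellative T -> (forall s t : T, exists x y : T, (x * s = y * t)%g) ->
  embeddable_in_group T.
Proof.
move=> T_can ore.
have cancL a b c : (a * b = a * c)%g -> b = c := (T_can a b c).1.
have cancR a b c : (b * a = c * a)%g -> b = c := (T_can a b c).2.
pose r (x y : T * T) := exists u v : T,
  (u * x.1 = v * y.1)%g /\ (u * x.2 = v * y.2)%g.
pose F (s : T) (x : T * T) := (x.1, x.2 * s)%g.
have [|x y [u [v [uv1 uv2]]]|x y z [u [u' [u1 u2]]] [v [v' [v1 v2]]]
     |s x y|s [x y]|s t st|X [act [act_bij actM act_inj]]] :=
    @quotient_bijections T _ r F.
- by move=> x; exists x.1, x.1.
- by exists v, u.
- have [a [b ab]] := ore u' v; exists (a * u)%g, (b * v')%g.
  by rewrite -!mulgA u1 u2 -v1 -v2 !mulgA ab.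
- split=> [[u [v [/= uv1 uv2]]]|[u [v [uv1 uv2]]]]; exists u, v; split=> //.
    by apply: (@cancR s); rewrite -!mulgA.
  by rewrite /= !mulgA uv2.
- have [u [v uv]] := ore y s; exists (u * x, v)%g, u, (u * u)%g.
  by rewrite /= -uv !mulgA.
- have [u [v [/= /cancR uv]]] := st (s, s).
  by rewrite uv => /cancL/cancL.
apply: (@embeddable_of_right_action T X (fun x s => act s x)) => //.
by move=> x s t; apply: actM => y; exists s, s; rewrite /= !mulgA.
Qed.

(** * Semigroups of monomials *)

(** The map [x |-> coef s * x ^ deg s] becomes injective once [x] and [y] are
    identified whenever [x ^ d = y ^ d] for some degree [d] of [T]. That [T]
    still acts faithfully is where cancellativity enters: if [coef s] and
    [coef t] have the same power of exponent [deg u], then [u * s = u * t]. *)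
Lemma embeddable_monomials (F : numClosedFieldType) (T : semigroupType) (t0 : T)
    (coef : T -> F) (deg : T -> nat) :
    cancellative T ->
    (forall s, coef s != 0%R) -> (forall s, (0 < deg s)%N) ->
    (forall s t, coef (s * t)%g = (coef s * coef t ^+ deg s)%R) ->
    (forall s t, deg (s * t)%g = (deg s * deg t)%N) ->
    (forall s t, coef s = coef t -> deg s = deg t -> s = t) ->
  embeddable_in_group T.
Proof.
move=> T_can coef0 deg0 coefM degM inj; have cancL a b c := (T_can a b c).1.
pose r (x y : F) := exists s, (x ^+ deg s = y ^+ deg s)%R.
pose act s (x : F) := (coef s * x ^+ deg s)%R.
have [|x y [s xy]|x y z [s xy] [t yz]|s x y|s y|s t st
     |X [g [g_bij gM g_inj]]] := @quotient_bijections T _ r act.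
- by move=> x; exists t0.
- by exists s.
- exists (s * t)%g; rewrite degM !exprM xy -!exprM mulnC !exprM.
  by rewrite yz.
- split=> [[t]|[t xy]].
    rewrite !exprMn => /(mulfI (expf_neq0 _ (coef0 s))) xy.
    by exists (s * t)%g; rewrite degM !exprM.
  by exists t; rewrite !exprMn -!exprM mulnC !exprM xy.
- exists ((deg s).-root (y / coef s))%R; exists t0.
  by rewrite /act rootCK // mulrC divfK.
- have [u] := st 1%R; have [v] := st 2%R.
  rewrite /act !expr1n !mulr1 => v2 u1.
  have norm1 : (`|coef s| = `|coef t|)%R.
    have := congr1 (fun x => `|x|%R) u1; rewrite !normrX.
    by move/eqP; rewrite eqrXn2 // => /eqP.
  have norm2 : (2 ^+ deg s = 2 ^+ deg t :> F)%R.
    have := congr1 (fun x => `|x|%R) v2; rewrite !normrX !normrM norm1.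
    move/eqP; rewrite eqrXn2 ?mulr_ge0 // => /eqP.
    by rewrite !normrX normr_nat => /mulfI; apply; rewrite normr_eq0.
  have degE : deg s = deg t.
    by apply/eqP; move/eqP: norm2; rewrite -!natrX eqr_nat eqn_exp2l.
  by apply: (cancL u); apply: inj; rewrite ?coefM ?degM ?u1 ?degE.
apply: (@embeddable_of_action T X g) => //.
move=> s t x; apply: gM => y; exists t0.
by congr (_ ^+ _)%R; rewrite /act coefM degM exprMn mulrA -exprM mulnC.
Qed.

(** * Free products *)

(** The action of van der Waerden: [G i] acts on the normal forms of the free
    product of the groups [G j] through the decomposition of such a word into
    a first letter in [G i], which may be trivial, and a word that does not
    begin in [G i]. *)
Section NormalForms.
Variables (I : choiceType) (G : I -> groupType).
Local Notation letter := {i : I & G i}.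
Implicit Types (x y : letter) (w : seq letter) (i : I).

Definition normal_form w :=
  sorted (fun x y => tag x != tag y) w && all (fun x => tagged x != 1%g) w.

Definition first_letter i w : G i :=
  if w is y :: _ then tagged_as (Tagged (fun i => G i) (1%g : G i)) y else 1%g.

Definition strip_letter i w :=
  if w is y :: w' then if tag y == i then w' else w else w.

Definition add_letter i (g : G i) w :=
  if g == 1%g then w else Tagged (fun i => G i) g :: w.

Definition avoids i w := if w is y :: _ then tag y != i else true.

Lemma add_first_letter i w :
  normal_form w -> add_letter (first_letter i w) (strip_letter i w) = w.
Proof.
case: w => [|[j h] w] /andP[_] /=; first by rewrite /add_letter eqxx.
move=> /andP[h1 _]; have [ji|ji] := eqVneq j i.
  by subst j; rewrite tagged_asE /add_letter (negbTE h1).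
rewrite /tagged_as /=; case: eqP => [ij|_]; last by rewrite /add_letter eqxx.
by rewrite ij eqxx in ji.
Qed.

Lemma first_add_letter i (g : G i) w :
  avoids i w -> first_letter i (add_letter g w) = g.
Proof.
rewrite /add_letter; case: eqP => [->|_ _] /=; last by rewrite tagged_asE.
case: w => [|[j h] w] //= ji; rewrite /tagged_as /=.
by case: eqP => // ij; rewrite ij eqxx in ji.
Qed.

Lemma strip_add_letter i (g : G i) w :
  avoids i w -> strip_letter i (add_letter g w) = w.
Proof.
rewrite /add_letter; case: eqP => [_|_ _] /=; last by rewrite eqxx.
by case: w => [|y w] //= /negbTE ->.
Qed.

Lemma normal_form_add_letter i (g : G i) w :
  avoids i w -> normal_form w -> normal_form (add_letter g w).
Proof.
rewrite /add_letter; have [//|g1] := eqVneq g 1%g.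
case: w => [_ _|y w] /=; first by rewrite /normal_form /= g1.
by rewrite /normal_form /= g1 eq_sym => -> /=.
Qed.

Lemma avoids_strip_letter i w : normal_form w -> avoids i (strip_letter i w).
Proof.
case: w => [//|y w] /andP[/= yw _].
case: ifP => [/eqP <-|/negbT //]; case: w yw => //= z w /andP[yz _].
by rewrite eq_sym.
Qed.

Lemma normal_form_strip_letter i w :
  normal_form w -> normal_form (strip_letter i w).
Proof.
case: w => [//|y w] yw; rewrite /strip_letter; case: ifP => // _.
by move: yw; rewrite /normal_form /= => /andP[/path_sorted -> /andP[_ ->]].
Qed.

Definition act_letter i (g : G i) w :=
  add_letter (g * first_letter i w)%g (strip_letter i w).

Lemma normal_form_act_letter i (g : G i) w :
  normal_form w -> normal_form (act_letter g w).
Proof.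
move=> wf; apply: normal_form_add_letter; first exact: avoids_strip_letter.
exact: normal_form_strip_letter.
Qed.

Lemma act_letterM i (g h : G i) w :
  normal_form w -> act_letter (g * h)%g w = act_letter g (act_letter h w).
Proof.
move=> wf; have av := avoids_strip_letter i wf.
by rewrite /act_letter first_add_letter // strip_add_letter // mulgA.
Qed.

Lemma act_letter1 i w : normal_form w -> act_letter (1%g : G i) w = w.
Proof. by move=> wf; rewrite /act_letter mul1g add_first_letter. Qed.
End NormalForms.

Section FreeProductEmbedding.
Variables (I : choiceType) (A : I -> semigroupType).
Local Notation letter := {i : I & A i}.
Local Notation tagA := (Tagged (fun i => A i)).

(** A trivial image of [a] makes [a] idempotent, and then [a * (a * b) = a * b]
    for each letter [b] of another factor, whereas [a * b <> b]. *)
Lemma free_product_no_idempotent (i : I) (a : A i) (b : letter) :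
  cancellative (free_product A) -> tag b != i -> (a * a)%g <> a.
Proof.
move=> fp_can bi aa.
have ab : reduced [:: tagA a; b] by rewrite /reduced /= eq_sym bi.
pose u := @FreeProduct _ A [:: tagA a] isT.
pose v := @FreeProduct _ A [:: b] isT.
have uv : (u * FreeProduct ab = u * v)%g.
  by apply: val_inj; rewrite /= eq_sym (negbTE bi) /= eqxx tagged_asE /= aa.
by have /(congr1 (fun w : free_product A => size w)) := (fp_can _ _ _).1 uv.
Qed.

(** The factors embed in groups [G i], and the free product acts letter by
    letter on the normal forms over the [G i]. The image of the empty word under
    a reduced word is its image in the [G i], provided that no letter becomes
    trivial; this holds as soon as there are two factors. *)
Lemma embeddable_free_product :
  cancellative (free_product A) -> (forall i, embeddable_in_group (A i)) ->
  embeddable_in_group (free_product A).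
Proof.
move=> fp_can A_emb.
pose G i := projT1 (cid (A_emb i)).
pose f i : {multiplicative A i -> G i} := projT1 (cid (projT2 (cid (A_emb i)))).
have f_inj i : injective (f i) := projT2 (cid (projT2 (cid (A_emb i)))).
pose X := {w : seq {i : I & G i} | normal_form w}.
pose actX i (g : G i) (w : X) : X :=
  exist (fun w => is_true (normal_form w)) _ (normal_form_act_letter g (valP w)).
pose act i (a : A i) := actX i (f i a).
have actM i (a b : A i) w : act i (a * b)%g w = act i a (act i b w).
  by apply: val_inj; rewrite /= gmulfM act_letterM //; exact: (valP w).
have act_bij i (a : A i) : bijective (act i a).
  exists (actX i (f i a)^-1%g) => w;
  by apply: val_inj; rewrite /= -act_letterM ?(valP w) // ?mulVg ?mulgV
    act_letter1 ?(valP w).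
pose run (u : seq letter) (w : X) : X :=
  foldr (fun x => act (tag x) (tagged x)) w u.
have run_reduce_cons x u w :
    run (reduce_cons x u) w = act (tag x) (tagged x) (run u w).
  case: x u => [i a] [|[j b] u] //=; case: eqP => //= ij; subst j.
  by rewrite tagged_asE actM.
have run_reduce u w : run (reduce u) w = run u w.
  by elim: u => //= x u IH; rewrite run_reduce_cons IH.
have nil_nf : @normal_form I G [::] by [].
pose x0 : X := exist (fun w => is_true (normal_form w)) _ nil_nf.
apply: (@embeddable_of_action (free_product A) X run) => [u|u v w|u v uv].
- elim: (free_word u) => [|x s IH] /=; first by exists id.
  exact: bij_comp (act_bij _ _) IH.
- by rewrite [LHS]run_reduce /run foldr_cat.
have [[x [y xy]]|one_tag] := pselect (exists x y : letter, tag x != tag y).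
  have f1 i (a : A i) : f i a != 1%g.
    apply/eqP => fa; have aa : (a * a)%g = a.
      by apply: (f_inj i); rewrite gmulfM fa mulg1.
    have [xi|xi] := eqVneq (tag x) i.
      apply: (@free_product_no_idempotent i a y) => //.
      by rewrite -xi eq_sym.
    exact: (@free_product_no_idempotent i a x).
  pose fl (x : letter) := Tagged (fun i => G i) (f (tag x) (tagged x)).
  have fl_inj : injective fl.
    case=> [i a] [j b]; rewrite /fl /= => ab.
    have ij : i = j := congr1 tag ab; subst j.
    by move/eqP: ab; rewrite eq_Tagged /= => /eqP/f_inj ->.
  have run_nil (s : seq letter) :
      sorted (fun x y => tag x != tag y) s -> val (run s x0) = map fl s.
    elim: s => //= z s IH zs; rewrite IH ?(path_sorted zs) //.
    have av : avoids (tag z) (map fl s).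
      by case: s zs {IH} => //= y' s /andP[]; rewrite eq_sym.
    rewrite /act_letter /add_letter.
    case: s av {IH zs} => [_|y' s /= y'z] /=.
      by rewrite mulg1 (negbTE (f1 _ _)).
    rewrite (negbTE y'z) /tagged_as /=; case: eqP => [E|_].
      by rewrite E eqxx in y'z.
    by rewrite mulg1 (negbTE (f1 _ _)).
  apply: val_inj; apply: (inj_map fl_inj) => /=.
  have /andP[_ us] := free_wordP u; have /andP[_ vs] := free_wordP v.
  by rewrite -!run_nil // uv.
(* All letters lie in a same factor, hence reduced words have length 1. *)
have tag_eq (x y : letter) : tag x = tag y.
  by apply/eqP/negPn/negP => xy; apply: one_tag; exists x, y.
have single (z : free_product A) :
    exists x : letter, z = [:: x] :> seq letter.
  case: z => -[|x [|y s]] //= us; first by exists x.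
  by have := us; rewrite /reduced /= (tag_eq x y) eqxx.
have [[i a] ua] := single u.
have [[j b] vb] := single v.
have ij : i = j := tag_eq (tagA a) (tagA b); subst j.
apply: val_inj; rewrite /= ua vb; congr [:: tagA _]; apply: (f_inj i).
have := congr1 (fun F => first_letter i (val (F x0))) uv.
by rewrite ua vb /= /act_letter /= !mulg1 !first_add_letter.
Qed.
End FreeProductEmbedding.

(** * Free semigroups of rank two *)

(** The free semigroup on two letters acts faithfully on the rationals through
    the affine maps [2 * t] and [2 * t + 1]: a word sends 1 to the number whose
    binary digits are a leading 1 and then the letters, from the last one to
    the first one. *)
Lemma embeddable_free2 (T : semigroupType) (word : T -> seq bool) :
    (forall s t, word (s * t)%g = word s ++ word t) -> injective word ->
  embeddable_in_group T.
Proof.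
move=> wordM word_inj.
pose aff (b : bool) (t : rat) := (2 * t + b%:R)%R.
pose act (w : seq bool) (t : rat) := foldr aff t w.
have aff_bij b : bijective (aff b).
  exists (fun t => (t - b%:R) / 2)%R => t; rewrite /aff.
    by rewrite addrK mulrC mulKf.
  by rewrite mulrCA mulfV // mulr1 subrK.
have act_nat w (n : nat) : exists m, act w n%:R%R = m%:R%R.
  elim: w => [|b w [m IH]] /=; first by exists n.
  by exists (2 * m + b)%N; rewrite IH /aff natrD natrM.
have aff_nat b c (m n : nat) : aff b m%:R%R = aff c n%:R%R -> b = c /\ m = n.
  rewrite /aff -!natrM -!natrD => /eqP; rewrite eqr_nat => /eqP E.
  have Eb : b = c.
    by have := congr1 odd E; rewrite !mul2n !oddD !odd_double !oddb.
  split=> //; move: E; rewrite Eb => /eqP.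
  by rewrite eqn_add2r eqn_pmul2l // => /eqP.
(* Nonempty words increase positive integers, so that only the empty word
   fixes 1. *)
have act_ge w (n : nat) m : act w n.+1%:R%R = m%:R%R ->
    (n < m)%N /\ (w != [::] -> (n.+1 < m)%N).
  elim: w m => [|b w IH] m /=; first by move/eqP; rewrite eqr_nat => /eqP <-.
  have [k kE] := act_nat w n.+1; rewrite kE; have [nk _] := IH _ kE.
  rewrite /aff -natrM -natrD => /eqP; rewrite eqr_nat => /eqP <-.
  have : (n.+1 < 2 * k + b)%N
    by rewrite ltn_addr // mul2n -addnn -[n.+2]add1n leq_add //
      (leq_trans _ nk).
  by move=> h; split=> // ; exact: ltnW.
have act_inj : injective act.
  move=> u v /(congr1 (fun F => F 1%R)).
  elim: u v => [|b u IH] [|c v] //= E.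
  - have [m mE] := act_nat (c :: v) 1.
    have [_ /(_ isT)] := act_ge (c :: v) 0 m mE.
    by move/eqP: mE; rewrite /= -E eq_sym pnatr_eq1 => /eqP ->.
  - have [m mE] := act_nat (b :: u) 1.
    have [_ /(_ isT)] := act_ge (b :: u) 0 m mE.
    by move/eqP: mE; rewrite /= E eq_sym pnatr_eq1 => /eqP ->.
  have [m mE] := act_nat u 1; have [n nE] := act_nat v 1.
  move: E; rewrite mE nE => /aff_nat[-> mn]; congr cons; apply: IH.
  by rewrite mE nE mn.
apply: (@embeddable_of_action T rat (fun s => act (word s))).
- move=> s; elim: (word s) => [|b w IH] /=; first by exists id.
  exact: bij_comp (aff_bij b) IH.
- by move=> s t x; rewrite wordM /act foldr_cat.
- by move=> s t /act_inj/word_inj.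
Qed.

(** * Germs at 0 of rational functions *)

Section Germs.
Local Open Scope ring_scope.
Variable K : numFieldType.
Implicit Types (F G H u v : K -> K) (p q : {poly K}).
Implicit Types (c z : K) (n : nat).

Definition germ_eq F G := \forall z \near (0 : K), F z = G z.

(** The local ring at 0 of the rational functions. It is handled through
    functions on [K], so that germs can be composed. *)
Definition regular F := exists p q : {poly K},
  q.[0] != 0 /\ germ_eq F (fun z => p.[z] / q.[z]).

Lemma germ_eq_refl F : germ_eq F F.
Proof. exact: filterE. Qed.

Lemma germ_eq_sym F G : germ_eq F G -> germ_eq G F.
Proof. by apply: filterS => z ->. Qed.

Lemma germ_eq_trans G F H : germ_eq F G -> germ_eq G H -> germ_eq F H.
Proof. by apply: filterS2 => z ->. Qed.

Lemma germ_eq0 F G : germ_eq F G -> F 0 = G 0.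
Proof. exact: nbhs_singleton. Qed.

Lemma regular_eq F G : germ_eq F G -> regular F -> regular G.
Proof.
move=> /germ_eq_sym FG [p [q [q0 Fpq]]].
by exists p, q; split=> //; exact: germ_eq_trans Fpq.
Qed.

Lemma horner_cvg p z : p.[x] @[x --> z] --> p.[z].
Proof.
elim/poly_ind: p => [|p c IH].
  rewrite horner0 (_ : horner 0 = cst 0);
    first exact: (@cvg_cst K 0 K (nbhs z) _).
  by apply/funext => x; rewrite horner0.
have -> : horner (p * 'X + c%:P) = (horner p \* id) \+ cst c.
  by apply/funext => x; rewrite hornerMXaddC.
exact: (cvgD (cvgM IH (@cvg_id _ (nbhs z))) (@cvg_cst K c K (nbhs z) _)).
Qed.

Lemma horner_near_neq0 p z : p.[z] != 0 -> \forall x \near z, p.[x] != 0.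
Proof.
move=> pz.
exact: (@cvgr_neq0 K K K (nbhs z) _ (horner p) p.[z] (@horner_cvg p z)).
Qed.

Lemma regular_cvg F : regular F -> F z @[z --> 0] --> F 0.
Proof.
move=> [p [q [q0 Fpq]]]; rewrite (germ_eq0 Fpq).
apply: cvg_trans (cvgM (@horner_cvg p 0) (cvgV q0 (@horner_cvg q 0))).
exact: (@near_eq_cvg K K (nbhs 0) _ _ _ (germ_eq_sym Fpq)).
Qed.

Lemma regular_neq0 F : regular F -> F 0 != 0 -> \forall z \near 0, F z != 0.
Proof.
move=> F_reg F0.
exact: (@cvgr_neq0 K K K (nbhs 0) _ F (F 0) (regular_cvg F_reg)).
Qed.

Lemma regular_horner p : regular (horner p).
Proof.
exists p, 1; rewrite hornerC oner_neq0; split=> //.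
by apply: filterE => z; rewrite hornerC divr1.
Qed.

Lemma regular_cst c : regular (fun=> c).
Proof.
apply: regular_eq (regular_horner c%:P).
by apply: filterE => z; rewrite hornerC.
Qed.

Lemma regular_id : regular id.
Proof.
by apply: regular_eq (regular_horner 'X); apply: filterE => z; rewrite hornerX.
Qed.

Lemma regularD F G : regular F -> regular G -> regular (fun z => F z + G z).
Proof.
move=> [p [q [q0 Fpq]]] [r [s [s0 Grs]]].
exists (p * s + r * q), (q * s); split; first by rewrite hornerM mulf_neq0.
have nzq := horner_near_neq0 q0; have nzs := horner_near_neq0 s0.
near=> z; rewrite (near Fpq z) // (near Grs z) // addf_div ?hornerE //.
  exact: (near nzq z).
exact: (near nzs z).
Unshelve. all: by end_near. Qed.

Lemma regularM F G : regular F -> regular G -> regular (fun z => F z * G z).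
Proof.
move=> [p [q [q0 Fpq]]] [r [s [s0 Grs]]].
exists (p * r), (q * s); split; first by rewrite hornerM mulf_neq0.
by move: Fpq Grs; apply: filterS2 => z -> ->; rewrite mulf_div !hornerM.
Qed.

Lemma regularN F : regular F -> regular (fun z => - F z).
Proof.
move=> /(regularM (regular_cst (- 1))); apply: regular_eq.
by apply: filterE => z; rewrite mulN1r.
Qed.

Lemma regularB F G : regular F -> regular G -> regular (fun z => F z - G z).
Proof. by move=> F_reg /regularN; exact: regularD. Qed.

Lemma regularX F n : regular F -> regular (fun z => F z ^+ n).
Proof.
move=> F_reg; elim: n => [|n IH]; first exact: regular_cst.
apply: regular_eq (regularM F_reg IH).
by apply: filterE => z; rewrite exprS.
Qed.

Lemma regularXn n : regular (fun z => z ^+ n).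
Proof. exact: regularX regular_id. Qed.

Lemma regularV F : regular F -> F 0 != 0 -> regular (fun z => (F z)^-1).
Proof.
move=> [p [q [q0 Fpq]]]; rewrite (germ_eq0 Fpq) mulf_eq0 negb_or => /andP[p0 _].
by exists q, p; split=> //; move: Fpq; apply: filterS => z ->; rewrite invf_div.
Qed.

Lemma regular_sum n (F : nat -> K -> K) :
  (forall i, regular (F i)) -> regular (fun z => \sum_(i < n) F i z).
Proof.
move=> F_reg; elim: n => [|n IH].
  apply: regular_eq (regular_cst 0).
  by apply: filterE => z; rewrite big_ord0.
apply: regular_eq (regularD IH (F_reg n)).
by apply: filterE => z; rewrite big_ord_recr.
Qed.

Lemma near_comp G (P : set K) :
  regular G -> G 0 = 0 -> (\forall z \near 0, P z) ->
  \forall z \near 0, P (G z).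
Proof. by move=> /regular_cvg + G0 PP; rewrite G0; apply. Qed.

Lemma germ_eq_comp F G H :
  regular H -> H 0 = 0 -> germ_eq F G -> germ_eq (F \o H) (G \o H).
Proof. exact: near_comp. Qed.

Lemma regular_horner_comp p G : regular G -> regular (fun z => p.[G z]).
Proof.
move=> G_reg; elim/poly_ind: p => [|p c IH].
  by apply: regular_eq (regular_cst 0); apply: filterE => z; rewrite horner0.
apply: regular_eq (regularD (regularM IH G_reg) (regular_cst c)).
by apply: filterE => z; rewrite hornerMXaddC.
Qed.

Lemma regular_comp F G : regular F -> regular G -> G 0 = 0 -> regular (F \o G).
Proof.
move=> [p [q [q0 Fpq]]] G_reg G0.
apply: regular_eq (germ_eq_sym (germ_eq_comp G_reg G0 Fpq)) _.
apply: regularM; first exact: regular_horner_comp.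
by apply: regularV; rewrite ?G0 //; exact: regular_horner_comp.
Qed.

Lemma horner_diff p u v : regular u -> regular v ->
  exists2 W, regular W & forall z, p.[u z] - p.[v z] = (u z - v z) * W z.
Proof.
move=> u_reg v_reg; elim/poly_ind: p => [|p c [W W_reg WE]].
  exists (fun=> 0); first exact: regular_cst.
  by move=> z; rewrite !horner0 subrr mulr0.
exists (fun z => p.[u z] + v z * W z).
  by apply: regularD; [exact: regular_horner_comp|exact: regularM].
move=> z; have /eqP := WE z; rewrite subr_eq !hornerMXaddC => /eqP ->.
ring.
Qed.

(** Transfers estimates of [u - v] to [F o u - F o v]. *)
Lemma regular_diff F u v : regular F -> regular u -> regular v ->
    u 0 = 0 -> v 0 = 0 ->
  exists2 W, regular W &
    germ_eq (fun z => F (u z) - F (v z)) (fun z => (u z - v z) * W z).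
Proof.
move=> [p [q [q0 Fpq]]] u_reg v_reg u0 v0.
have [Wp Wp_reg WpE] := horner_diff p u_reg v_reg.
have [Wq Wq_reg WqE] := horner_diff q u_reg v_reg.
have qu_reg := regular_horner_comp q u_reg.
have qv_reg := regular_horner_comp q v_reg.
have qu0 : q.[u 0] != 0 by rewrite u0.
have qv0 : q.[v 0] != 0 by rewrite v0.
exists (fun z => (Wp z * q.[v z] - p.[v z] * Wq z) / (q.[u z] * q.[v z])).
  apply: regularM; last by apply: regularV; [exact: regularM|rewrite mulf_neq0].
  by apply: regularB; apply: regularM => //; exact: regular_horner_comp.
have nqu := regular_neq0 qu_reg qu0; have nqv := regular_neq0 qv_reg qv0.
have Fu := germ_eq_comp u_reg u0 Fpq; have Fv := germ_eq_comp v_reg v0 Fpq.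
near=> z.
have quz : q.[u z] != 0 by exact: (near nqu z).
have qvz : q.[v z] != 0 by exact: (near nqv z).
have := near Fu z; have := near Fv z; rewrite /= => -> // -> //.
have /eqP := WpE z; rewrite subr_eq => /eqP ->.
rewrite mulrA mulrBr (mulrCA _ _ (Wq z)) -(WqE z).
by field; rewrite quz qvz.
Unshelve. all: by end_near. Qed.

(** Otherwise [p] is a power of [z] times a polynomial that does not vanish
    at 0. *)
Lemma horner_dnbhs0 p : (\forall z \near 0^', p.[z] = 0) -> p = 0.
Proof.
move=> p0; apply/eqP/negPn/negP => pn0.
have [n [q + pE]] := multiplicity_XsubC p 0; rewrite pn0 /= => q0.
have nq : \forall z \near 0^', q.[z] != 0.
  by apply: nbhs_dnbhs; exact: horner_near_neq0.
have [z [/= pz qz z0]] :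
    exists z, [/\ p.[z] = 0, q.[z] != 0 & z != 0].
  apply: (@filter_ex _ (0 : K)^'); near=> z; split.
  - exact: (near p0 z).
  - exact: (near nq z).
  - near: z; exact: nbhs_dnbhs_neq.
move/eqP: pz; rewrite pE hornerM horner_exp hornerXsubC subr0 mulf_eq0.
by rewrite (negbTE qz) expf_eq0 (negbTE z0) andbF.
Unshelve. all: by end_near. Qed.

Lemma regular_dnbhs_eq F G : regular F -> regular G ->
  (\forall z \near 0^', F z = G z) -> germ_eq F G.
Proof.
move=> [p [q [q0 Fpq]]] [r [s [s0 Grs]]] FG.
have nq := horner_near_neq0 q0; have ns := horner_near_neq0 s0.
have dF := nbhs_dnbhs Fpq; have dG := nbhs_dnbhs Grs.
have dq := nbhs_dnbhs nq; have ds := nbhs_dnbhs ns.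
have : p * s - r * q = 0.
  apply: horner_dnbhs0; near=> z; rewrite !hornerE; apply/eqP; rewrite subr_eq0.
  have qz : q.[z] != 0 by exact: (near dq z).
  have sz : s.[z] != 0 by exact: (near ds z).
  rewrite -eqr_div //; apply/eqP.
  by rewrite -(near dF z) // -(near dG z) // (near FG z).
move/eqP; rewrite subr_eq0 => /eqP psrq; near=> z.
have qz : q.[z] != 0 by exact: (near nq z).
have sz : s.[z] != 0 by exact: (near ns z).
rewrite (near Fpq z) // (near Grs z) //; apply/eqP.
by rewrite eqr_div // -!hornerM psrq.
Unshelve. all: by end_near. Qed.

Lemma regular_cancel F G H : regular F -> regular G ->
  (\forall z \near 0^', H z != 0) ->
  germ_eq (fun z => H z * F z) (fun z => H z * G z) -> germ_eq F G.
Proof.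
move=> F_reg G_reg H0 /nbhs_dnbhs HFG; apply: regular_dnbhs_eq => //.
by move: H0 HFG; apply: filterS2 => z /mulfI; apply.
Qed.
End Germs.

Arguments regular_id {K}.
Arguments regularXn {K} n.

(** * Leading terms and relative errors *)

Section Leading.
Local Open Scope ring_scope.
Variable K : numFieldType.
Implicit Types (F G H u v : K -> K) (p q : {poly K}).
Implicit Types (a b c z : K) (k m n : nat).

Lemma dnbhs0_expf_neq0 n : \forall z \near (0 : K)^', z ^+ n != 0.
Proof.
have := nbhs_dnbhs_neq (0 : K); apply: filterS => z z0.
exact: expf_neq0.
Qed.

Definition leading F a n := exists U,
  [/\ regular U, U 0 = a, a != 0 & germ_eq F (fun z => z ^+ n * U z)].

Lemma leading_regular F a n : leading F a n -> regular F.
Proof.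
move=> [U [U_reg _ _ /germ_eq_sym/regular_eq]]; apply.
exact: regularM (regularXn n) U_reg.
Qed.

Lemma leading_eq F G a n : germ_eq F G -> leading F a n -> leading G a n.
Proof.
move=> /germ_eq_sym FG [U [U_reg U0 a0 FU]].
by exists U; split=> //; exact: germ_eq_trans FU.
Qed.

Lemma leading_at0 F a n : (0 < n)%N -> leading F a n -> F 0 = 0.
Proof.
by move=> n0 [U [_ _ _ /germ_eq0 ->]]; rewrite expr0n eqn0Ngt n0 mul0r.
Qed.

Lemma leading_id : leading id 1 1.
Proof.
exists (fun=> 1); split=> //; first exact: regular_cst.
by apply: filterE => z; rewrite mulr1.
Qed.

Lemma leading_comp F G a b n m : (0 < m)%N ->
  leading F a n -> leading G b m -> leading (F \o G) (a * b ^+ n) (n * m).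
Proof.
move=> m0 [U [U_reg U0 a0 FU]] G_lead.
have G_reg := leading_regular G_lead; have G0 := leading_at0 m0 G_lead.
have [V [V_reg V0 b0 GV]] := G_lead.
exists (fun z => U (G z) * V z ^+ n); split.
- by apply: regularM; [exact: regular_comp|exact: regularX].
- by rewrite G0 U0 V0.
- by rewrite mulf_neq0 // expf_neq0.
have := germ_eq_comp G_reg G0 FU; move: GV; apply: filterS2 => z GV /= ->.
by rewrite [X in X ^+ n]GV exprMn -exprM mulnC mulrA mulrAC -mulrA.
Qed.

Lemma leadingX F a n m :
  leading F a n -> leading (fun z => F z ^+ m) (a ^+ m) (n * m).
Proof.
move=> [U [U_reg U0 a0 FU]]; exists (fun z => U z ^+ m); split.
- exact: regularX.
- by rewrite U0.
- exact: expf_neq0.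
- by move: FU; apply: filterS => z ->; rewrite exprMn exprM.
Qed.

Lemma leading_unique F a b n m :
  leading F a n -> leading F b m -> a = b /\ n = m.
Proof.
wlog nm : a b n m / (n <= m)%N => [wlg Fa Fb|].
  have [/wlg|/ltnW/wlg] := leqP n m; first by apply.
  by move=> /(_ _ _ Fb Fa)[].
move=> [U [U_reg U0 a0 FU]] [V [V_reg V0 b0 FV]].
have UV : germ_eq U (fun z => z ^+ (m - n) * V z).
  apply: (@regular_cancel _ _ _ (fun z => z ^+ n)) => //.
  - exact: regularM (regularXn _) V_reg.
  - exact: dnbhs0_expf_neq0.
  - move: FU FV; apply: filterS2 => z -> /=.
    by rewrite mulrA -exprD subnKC.
have := germ_eq0 UV; rewrite U0 V0 expr0n subn_eq0.
have [mn|] := leqP m n; last by rewrite mul0r => _ a0'; rewrite a0' eqxx in a0.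
by rewrite mul1r; split=> //; apply/eqP; rewrite eqn_leq nm.
Qed.

Lemma regular_leading F :
  regular F -> germ_eq F (fun=> 0) \/ exists a n, leading F a n.
Proof.
move=> [p [q [q0 Fpq]]]; have [p0|pn0] := eqVneq p 0.
  by left; move: Fpq; apply: filterS => z ->; rewrite p0 horner0 mul0r.
right; have [n [r + pE]] := multiplicity_XsubC p 0; rewrite pn0 /= => r0.
exists (r.[0] / q.[0]), n, (fun z => r.[z] / q.[z]); split=> //.
- apply: regularM; first exact: regular_horner.
  by apply: regularV; first exact: regular_horner.
- by rewrite mulf_neq0 // invr_neq0.
move: Fpq; apply: filterS => z ->.
by rewrite pE hornerM horner_exp hornerXsubC subr0 mulrA (mulrC _ r.[z]).
Qed.

(** Equality up to a constant factor and a relative error [O(z ^+ k)]: this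
    compares [phi o f] with a power of [phi], for a function [phi] that is only
    known up to a constant factor and a relative error. *)
Definition proportional k u v := exists c E,
  [/\ c != 0, regular E & germ_eq u (fun z => v z * (c + z ^+ k * E z))].

Lemma germ_eq_proportional k u v : germ_eq u v -> proportional k u v.
Proof.
move=> uv; exists 1, (fun=> 0); split=> //; first exact: regular_cst.
by move: uv; apply: filterS => z ->; rewrite mulr0 addr0 mulr1.
Qed.

Lemma proportional_sym k u v :
  (0 < k)%N -> proportional k u v -> proportional k v u.
Proof.
move=> k0 [c [E [c0 E_reg uv]]].
have C_reg : regular (fun z => c + z ^+ k * E z).
  by apply: regularD; [exact: regular_cst|exact: regularM (regularXn _) E_reg].
have C0 : c + 0 ^+ k * E 0 != 0 by rewrite expr0n eqn0Ngt k0 mul0r addr0.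
exists c^-1, (fun z => - (E z / (c * (c + z ^+ k * E z)))); split.
- by rewrite invr_neq0.
- apply/regularN/regularM => //; apply: regularV; last by rewrite mulf_neq0.
  by apply: regularM => //; exact: regular_cst.
move: uv (regular_neq0 C_reg C0); apply: filterS2 => z -> Cz /=.
by field; rewrite c0 Cz.
Qed.

Lemma proportional_trans k u v w :
  proportional k u v -> proportional k v w -> proportional k u w.
Proof.
move=> [c [E [c0 E_reg uv]]] [d [D [d0 D_reg vw]]].
exists (d * c), (fun z => d * E z + D z * (c + z ^+ k * E z)); split.
- exact: mulf_neq0.
- apply: regularD; first by apply: regularM => //; exact: regular_cst.
  apply: regularM => //; apply: regularD; first exact: regular_cst.
  exact: regularM (regularXn _) E_reg.
by move: uv vw; apply: filterS2 => z -> -> /=; ring.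
Qed.

Lemma proportionalM k u v u' v' : proportional k u v -> proportional k u' v' ->
  proportional k (fun z => u z * u' z) (fun z => v z * v' z).
Proof.
move=> [c [E [c0 E_reg uv]]] [d [D [d0 D_reg uv']]].
exists (d * c), (fun z => d * E z + D z * (c + z ^+ k * E z)); split.
- exact: mulf_neq0.
- apply: regularD; first by apply: regularM => //; exact: regular_cst.
  apply: regularM => //; apply: regularD; first exact: regular_cst.
  exact: regularM (regularXn _) E_reg.
by move: uv uv'; apply: filterS2 => z -> -> /=; ring.
Qed.

Lemma proportionalX k u v m :
  proportional k u v -> proportional k (fun z => u z ^+ m) (fun z => v z ^+ m).
Proof.
move=> uv; elim: m => [|m IH]; first exact/germ_eq_proportional/germ_eq_refl.
under eq_fun do rewrite exprS.
under [X in proportional _ _ X]eq_fun do rewrite exprS.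
exact: proportionalM.
Qed.

Lemma proportional_le k m u v :
  (k <= m)%N -> proportional m u v -> proportional k u v.
Proof.
move=> km [c [E [c0 E_reg uv]]]; exists c, (fun z => z ^+ (m - k) * E z).
split=> //; first exact: regularM (regularXn _) E_reg.
by move: uv; apply: filterS => z ->; rewrite mulrA -exprD subnKC.
Qed.

Lemma proportional_comp k u v F a n : (0 < n)%N -> leading F a n ->
  proportional k u v -> proportional (n * k) (u \o F) (v \o F).
Proof.
move=> n0 F_lead [c [E [c0 E_reg uv]]].
have F_reg := leading_regular F_lead; have F0 := leading_at0 n0 F_lead.
have [U [U_reg _ _ FU]] := F_lead.
exists c, (fun z => U z ^+ k * E (F z)); split=> //.
  by apply: regularM; [exact: regularX|exact: regular_comp].
move: (germ_eq_comp F_reg F0 uv) FU; apply: filterS2 => z /= -> FU.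
by rewrite [X in X ^+ k]FU exprMn -exprM mulrA.
Qed.

Lemma leading_ratio F G a b n : leading F a n -> leading G b n ->
  exists H, [/\ regular H, H 0 = a / b & germ_eq F (fun z => G z * H z)].
Proof.
move=> [U [U_reg U0 a0 FU]] [V [V_reg V0 b0 GV]].
have V0' : V 0 != 0 by rewrite V0.
exists (fun z => U z / V z); split; last 1 first.
- move: (regular_neq0 V_reg V0') FU GV; apply: filterS3 => z Vz -> ->.
  by field.
- by apply: regularM => //; exact: regularV.
- by rewrite U0 V0.
Qed.

Lemma proportional1 F G a b n :
  leading F a n -> leading G b n -> proportional 1 F G.
Proof.
move=> Fl Gl; have [H [H_reg H0 FGH]] := leading_ratio Fl Gl.
have [W W_reg WE] :=
  regular_diff H_reg regular_id (regular_cst 0) erefl erefl.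
exists (a / b), W; split=> //.
  have [_ [_ _ a0 _]] := Fl; have [_ [_ _ b0 _]] := Gl.
  by rewrite mulf_neq0 // invr_neq0.
move: FGH WE; apply: filterS2 => z ->.
rewrite subr0 -H0 expr1 => /eqP; rewrite subr_eq => /eqP ->.
by rewrite addrC.
Qed.

(** In characteristic 0, [H - H 0] is the product of [H ^+ m - H 0 ^+ m] and a
    unit. *)
Lemma regular_root H E c m k : regular H -> regular E -> H 0 != 0 ->
    (0 < m)%N -> (0 < k)%N ->
    germ_eq (fun z => H z ^+ m) (fun z => c + z ^+ k * E z) ->
  exists2 D, regular D & germ_eq H (fun z => H 0 + z ^+ k * D z).
Proof.
move=> H_reg E_reg H0 m0 k0 HE.
pose W z := \sum_(i < m) H z ^+ (m.-1 - i) * H 0 ^+ i.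
have W_reg : regular W.
  apply: (regular_sum m (F := fun i z => H z ^+ (m.-1 - i) * H 0 ^+ i)) => i.
  by apply: regularM; [exact: regularX|exact: regular_cst].
have W0 : W 0 != 0.
  rewrite /W (eq_bigr (fun=> H 0 ^+ m.-1)) => [|i _].
    rewrite sumr_const card_ord -mulr_natr mulf_neq0 ?expf_neq0 //.
    by rewrite pnatr_eq0 -lt0n.
  by rewrite -exprD subnK // -ltnS prednK.
have cE : c = H 0 ^+ m.
  by have := germ_eq0 HE; rewrite expr0n eqn0Ngt k0 mul0r addr0.
exists (fun z => E z / W z); first by apply: regularM => //; exact: regularV.
move: HE (regular_neq0 W_reg W0); apply: filterS2 => z HEz Wz.
rewrite mulrA; apply/eqP; rewrite addrC -subr_eq eq_sym.
rewrite -(inj_eq (mulIf Wz)) divfK // /W -subrXX HEz cE.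
by rewrite addrC addKr.
Qed.

(** The ratio of [u] and [v] is a unit, to which [regular_root] applies. *)
Lemma proportional_root k m u v a b n : (0 < k)%N -> (0 < m)%N ->
    leading u a n -> leading v b n ->
    proportional k (fun z => u z ^+ m) (fun z => v z ^+ m) ->
  proportional k u v.
Proof.
move=> k0 m0 ul vl [c [E [c0 E_reg uvE]]].
have [H [H_reg H0 uvH]] := leading_ratio ul vl.
have [_ [_ _ a0 _]] := ul; have [V [V_reg V0 b0 vV]] := vl.
have H00 : H 0 != 0 by rewrite H0 mulf_neq0 // invr_neq0.
have HE : germ_eq (fun z => H z ^+ m) (fun z => c + z ^+ k * E z).
  apply: (@regular_cancel _ _ _ (fun z => v z ^+ m)).
  - exact: regularX.
  - apply: regularD; first exact: regular_cst.
    exact: regularM (regularXn _) E_reg.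
  - have V0' : V 0 != 0 by rewrite V0.
    have Vn := nbhs_dnbhs (regular_neq0 V_reg V0'); have vn := nbhs_dnbhs vV.
    near=> z; rewrite expf_neq0 // (near vn z) // mulf_neq0 //.
      by near: z; exact: dnbhs0_expf_neq0.
    exact: (near Vn z).
  - by move: uvE uvH; apply: filterS2 => z + uz; rewrite uz exprMn.
have [D D_reg HD] := regular_root H_reg E_reg H00 m0 k0 HE.
exists (H 0), D; split=> //.
by move: uvH HD; apply: filterS2 => z -> ->.
Unshelve. all: by end_near. Qed.
End Leading.

(** * Words in two superattracting germs *)

Definition run (X : Type) (g : bool -> X -> X) (w : seq bool) : X -> X :=
  foldr (fun b F => g b \o F) id w.

Lemma run_cat (X : Type) (g : bool -> X -> X) u v :
  run g (u ++ v) = run g u \o run g v.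
Proof. by elim: u => //= b u ->. Qed.

Section Words.
Local Open Scope ring_scope.
Variable K : numFieldType.
Variables (g : bool -> K -> K) (a : bool -> K) (n : bool -> nat).
Hypothesis g_leading : forall b, leading (g b) (a b) (n b).
Hypothesis n_gt1 : forall b, (1 < n b)%N.

Definition word_order (w : seq bool) : nat :=
  foldr (fun b d => n b * d)%N 1%N w.

Let n_gt0 b : (0 < n b)%N. Proof. exact: ltnW. Qed.

Lemma word_order_gt0 w : (0 < word_order w)%N.
Proof. by elim: w => //= b w IH; rewrite muln_gt0 n_gt0. Qed.

Lemma word_order_rcons w b : word_order (rcons w b) = (word_order w * n b)%N.
Proof. by elim: w => [|c w IH] /=; rewrite ?muln1 ?mul1n // IH mulnA. Qed.

Lemma run_leading w : exists c, leading (run g w) c (word_order w).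
Proof.
elim: w => [|b w [c IH]]; first by exists 1; exact: leading_id.
exists (a b * c ^+ n b).
exact: (leading_comp (word_order_gt0 w) (g_leading b) IH).
Qed.

Local Notation Phi N := (run g (nseq N false)).

Lemma word_order_nseq N : word_order (nseq N false) = (n false ^ N)%N.
Proof. by elim: N => //= N ->; rewrite expnS. Qed.

Lemma iterate_commute N : Phi N \o g false = g false \o Phi N.
Proof.
elim: N => //= N IH.
by rewrite -[LHS]/(g false \o (Phi N \o g false)) IH.
Qed.

(** The iterates [g false ^N] replace a Boettcher coordinate of [g false]: such
    a coordinate is the limit of their roots of exponents [n false ^ N]. *)
Lemma iterate_proportional N :
  proportional (n false ^ N) (Phi N \o g false) (fun z => Phi N z ^+ n false).
Proof.
have [c] := run_leading (nseq N false); rewrite word_order_nseq => Phil.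
have D0 : (0 < n false ^ N)%N by rewrite expn_gt0 n_gt0.
have Phi0 := leading_at0 D0 Phil; have Phi_reg := leading_regular Phil.
have [U [U_reg U0 a0 gU]] := g_leading false.
have [V [V_reg _ _ PhiV]] := Phil.
have [W W_reg WE] :=
  regular_diff U_reg Phi_reg (regular_cst 0) Phi0 erefl.
rewrite iterate_commute; exists (a false), (fun z => V z * W z); split=> //.
  exact: regularM.
move: (germ_eq_comp Phi_reg Phi0 gU) PhiV WE; apply: filterS3 => z /= -> PhiV.
rewrite subr0 U0 => /eqP; rewrite subr_eq => /eqP ->.
by rewrite mulrA -PhiV addrC.
Qed.

(** A coordinate in which both letters are monomials up to order [k] makes all
    words monomials up to order [k]. *)
Lemma word_proportional N k : (0 < k)%N ->
    (forall b, proportional k (Phi N \o g b) (fun z => Phi N z ^+ n b)) ->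
  forall w,
    proportional k (Phi N \o run g w) (fun z => Phi N z ^+ word_order w).
Proof.
move=> k0 gk; elim=> [|b w IH] /=.
  by apply/germ_eq_proportional/filterE => z; rewrite expr1.
have [c wl] := run_leading w.
have := proportional_comp (word_order_gt0 w) wl (gk b).
move=> /(proportional_le (leq_pmull _ (word_order_gt0 w)))/proportional_trans.
apply; rewrite mulnC; under [X in proportional _ _ X]eq_fun do rewrite exprM.
exact: proportionalX.
Qed.

Section Relation.
Variables A B : seq bool.
Hypothesis AB : germ_eq (run g (rcons A true)) (run g (rcons B false)).

(** Precomposition with [g true] or [g false] raises the order of relative
    errors, so that the relation turns an estimate of order [k] for the word
    [A] into one of order [k.+1] for the last letter [g true]. *)
Lemma relation_proportional N k : (0 < k <= n false ^ N)%N ->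
  proportional k (Phi N \o g true) (fun z => Phi N z ^+ n true).
Proof.
have [c] := run_leading (nseq N false); rewrite word_order_nseq => Phil.
have D0 : (0 < n false ^ N)%N by rewrite expn_gt0 n_gt0.
have gtl := leading_comp (n_gt0 true) Phil (g_leading true).
have Xl := leadingX (n true) Phil.
have orders : (word_order A * n true = word_order B * n false)%N.
  have [d Al] := run_leading (rcons A true).
  have [e Bl] := run_leading (rcons B false).
  have [_] := leading_unique (leading_eq AB Al) Bl.
  by rewrite !word_order_rcons.
elim: k => // k IH /= kN.
have [->|k0] := posnP k; first exact: proportional1 gtl Xl.
have gk b : proportional k (Phi N \o g b) (fun z => Phi N z ^+ n b).
  case: b; first by apply: IH; rewrite k0 ltnW.
  exact: proportional_le (ltnW kN) (iterate_proportional N).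
have last w b : proportional k.+1 (Phi N \o run g (rcons w b))
    (fun z => Phi N (g b z) ^+ word_order w).
  rewrite -cats1 run_cat; have := word_proportional k0 gk w.
  move=> /(proportional_comp (n_gt0 b) (g_leading b)); apply: proportional_le.
  by rewrite (leq_trans _ (leq_mul (n_gt1 b) (leqnn k))) //
    mul2n -addnn -addn1 leq_add2l.
apply: (proportional_root (m := word_order A)) gtl Xl _ => //.
  exact: word_order_gt0.
apply: proportional_trans (proportional_sym _ (last A true)) _ => //.
have AB' :
    germ_eq (Phi N \o run g (rcons A true)) (Phi N \o run g (rcons B false)).
  by move: AB; apply: filterS => z /= ->.
apply: proportional_trans (germ_eq_proportional _ AB') _.
apply: proportional_trans (last B false) _.
under [X in proportional _ _ X]eq_fun do rewrite -exprM mulnC orders mulnC exprM.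
apply: proportionalX; exact: proportional_le kN (iterate_proportional N).
Qed.

(** If [run g u = run g v * (1 + t * z ^+ j + o(z ^+ j))] with [t != 0], then
    composing with an iterate [Phi N] of order [D > j] yields the factor
    [1 + D * t * z ^+ j + o(z ^+ j)], whereas both composites are proportional
    to the same power of [Phi N] up to order [D]. *)
Lemma leading_determines_word u v c d :
  leading (run g u) c d -> leading (run g v) c d -> germ_eq (run g u) (run g v).
Proof.
move=> ul vl.
have [[cu ul'] [cv vl']] := (run_leading u, run_leading v).
have [_ du] := leading_unique ul ul'; have [_ dv] := leading_unique vl vl'.
have d0 : (0 < d)%N by rewrite du word_order_gt0.
have [H [H_reg H0 uvH]] := leading_ratio ul vl.
have [_ [_ _ c0 _]] := ul; rewrite divff // in H0.
have [H1|[t [j [T [T_reg T0 t0 HT]]]]] :=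
    regular_leading (regularB H_reg (regular_cst 1)).
  move: uvH H1; apply: filterS2 => z -> /eqP.
  by rewrite subr_eq0 => /eqP ->; rewrite mulr1.
exfalso; pose N := j.+1; pose D := (n false ^ N)%N.
have jD : (j.+1 <= D)%N by rewrite ltnW // ltn_expl.
have D0 : (0 < D)%N by exact: leq_trans jD.
have [cN] := run_leading (nseq N false); rewrite word_order_nseq -/D => Phil.
have gj b : proportional j.+1 (Phi N \o g b) (fun z => Phi N z ^+ n b).
  case: b; first exact: relation_proportional.
  exact: proportional_le jD (iterate_proportional N).
have [e [E [e0 E_reg PhiE]]] :
    proportional j.+1 (Phi N \o run g u) (Phi N \o run g v).
  apply: proportional_trans (word_proportional (ltn0Sn j) gj u) _.
  rewrite -du dv; apply: proportional_sym => //.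
  exact: (word_proportional (ltn0Sn j) gj v).
have [U [U_reg U0 cN0 PhiU]] := Phil.
have [u_reg v_reg] := (leading_regular ul, leading_regular vl).
have [u0 v0] := (leading_at0 d0 ul, leading_at0 d0 vl).
have [W W_reg WE] := regular_diff U_reg u_reg v_reg u0 v0.
have [V [V_reg V0 _ vV]] := vl.
have Uv_reg := regular_comp U_reg v_reg v0.
have Uv0 : (U \o run g v) 0 != 0 by rewrite /= v0 U0.
pose Q z := E z - H z ^+ D * (z ^+ d.-1 * V z * T z * W z / U (run g v z)).
have Q_reg : regular Q.
  apply: regularB => //; apply: regularM; first exact: regularX.
  apply: regularM; last exact: regularV.
  do 2![apply: regularM => //]; apply: regularM => //; exact: regularXn.
have HQ : germ_eq (fun z => H z ^+ D) (fun z => e + z ^+ j.+1 * Q z).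
  apply: (@regular_cancel _ _ _ (fun z => run g v z ^+ D)).
  - exact: regularX.
  - apply: regularD; first exact: regular_cst.
    exact: regularM (regularXn _) Q_reg.
  - have V0' : V 0 != 0 by rewrite V0.
    have Vn := nbhs_dnbhs (regular_neq0 V_reg V0'); have vn := nbhs_dnbhs vV.
    near=> z; rewrite expf_neq0 // (near vn z) // mulf_neq0 //.
      by near: z; exact: dnbhs0_expf_neq0.
    exact: (near Vn z).
  have Uvn := regular_neq0 Uv_reg Uv0.
  have Phiu := germ_eq_comp u_reg u0 PhiU.
  have Phiv := germ_eq_comp v_reg v0 PhiU.
  near=> z.
  have Uvz : U (run g v z) != 0 by exact: (near Uvn z).
  have uz : run g u z = run g v z * H z by exact: (near uvH z).
  have vz : run g v z = z ^+ d * V z by exact: (near vV z).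
  have Tz : H z - 1 = z ^+ j * T z by exact: (near HT z).
  have Wz : U (run g u z) - U (run g v z) = (run g u z - run g v z) * W z.
    exact: (near WE z).
  have Phiuz : Phi N (run g u z) = run g u z ^+ D * U (run g u z).
    exact: (near Phiu z).
  have Phivz : Phi N (run g v z) = run g v z ^+ D * U (run g v z).
    exact: (near Phiv z).
  have PhiEz : Phi N (run g u z) = Phi N (run g v z) * (e + z ^+ j.+1 * E z).
    exact: (near PhiE z).
  have uvz : run g u z - run g v z = z * z ^+ d.-1 * V z * (z ^+ j * T z).
    by rewrite uz -[X in _ - X]mulr1 -mulrBr Tz [in LHS]vz -exprS prednK.
  have key : run g v z ^+ D * H z ^+ D *
      (U (run g v z) + z * z ^+ d.-1 * V z * (z ^+ j * T z) * W z) =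
      run g v z ^+ D * U (run g v z) * (e + z ^+ j.+1 * E z).
    by rewrite -Phivz -PhiEz Phiuz uz exprMn -uz -uvz -Wz addrC subrK.
  apply: (mulIf Uvz).
  transitivity (run g v z ^+ D * U (run g v z) * (e + z ^+ j.+1 * E z) -
    run g v z ^+ D * H z ^+ D * (z * z ^+ d.-1 * V z * (z ^+ j * T z) * W z)).
    by rewrite -key; ring.
  by rewrite /Q exprS; field.
have H00 : H 0 != 0 by rewrite H0 oner_neq0.
have [S S_reg HS] := regular_root H_reg Q_reg H00 D0 (ltn0Sn j) HQ.
have TS : germ_eq T (fun z => z * S z).
  apply: (@regular_cancel _ _ _ (fun z => z ^+ j)) => //.
  - exact: regularM regular_id S_reg.
  - exact: dnbhs0_expf_neq0.
  by move: HT HS; apply: filterS2 => z <- ->; rewrite H0 mulrA -exprSr addrC addKr.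
by move: t0; rewrite -T0 (germ_eq0 TS) mul0r eqxx.
Unshelve. all: by end_near. Qed.
End Relation.
End Words.

(** * Maps of the sphere in homogeneous coordinates *)

Section Forms.
Local Open Scope ring_scope.
Variable K : numFieldType.
Implicit Types (u v : K -> K -> K) (x y z c : K).

(** Binary forms, presented by their construction: closure under substitution
    and homogeneity are then inductions. *)
Inductive form : nat -> (K -> K -> K) -> Prop :=
| form_cst c : form 0 (fun _ _ => c)
| form_fst : form 1 (fun x _ => x)
| form_snd : form 1 (fun _ y => y)
| form_add d u v : form d u -> form d v -> form d (fun x y => u x y + v x y)
| form_mul d e u v :
    form d u -> form e v -> form (d + e) (fun x y => u x y * v x y).

Lemma form_exp k u : form 1 u -> form k (fun x y => u x y ^+ k).
Proof.
move=> uf; elim: k => [|k IH]; first exact: (form_cst 1).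
under eq_fun do under eq_fun do rewrite exprS.
exact: (form_mul uf IH).
Qed.

Lemma form_monomial c i j : form (i + j) (fun x y => c * x ^+ i * y ^+ j).
Proof.
exact: (form_mul (form_mul (form_cst c) (form_exp i form_fst))
  (form_exp j form_snd)).
Qed.

Lemma form_comp d e u v w : form d u -> form e v -> form e w ->
  form (d * e) (fun x y => u (v x y) (w x y)).
Proof.
move=> ud vf wf; elim: ud => [c|||d' u1 u2 _ IH1 _ IH2|d1 d2 u1 u2 _ IH1 _ IH2].
- by rewrite mul0n; exact: form_cst.
- by rewrite mul1n.
- by rewrite mul1n.
- exact: form_add.
- by rewrite mulnDl; exact: form_mul.
Qed.

Lemma form_homogeneous d u c x y :
  form d u -> u (c * x) (c * y) = c ^+ d * u x y.
Proof.
elim=> [a|||d' u1 u2 _ IH1 _ IH2|d1 d2 u1 u2 _ IH1 _ IH2].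
- by rewrite mul1r.
- by rewrite expr1.
- by rewrite expr1.
- by rewrite IH1 IH2 mulrDr.
- by rewrite IH1 IH2 exprD mulrACA.
Qed.

Lemma form_polynomial d u (p q : {poly K}) : form d u ->
  exists r : {poly K}, forall z, u p.[z] q.[z] = r.[z].
Proof.
elim=> [c|||d' u1 u2 _ [r rE] _ [s sE]|d1 d2 u1 u2 _ [r rE] _ [s sE]].
- by exists c%:P => z; rewrite hornerC.
- by exists p.
- by exists q.
- by exists (r + s) => z; rewrite hornerD rE sE.
- by exists (r * s) => z; rewrite hornerM rE sE.
Qed.

Lemma form_eq0 d u : form d u -> (\forall z \near 0, u z 1 = 0) ->
  forall x y, u x y = 0.
Proof.
move=> uf u0; have u1 x : u x 1 = 0.
  have [p pE] := form_polynomial 'X 1%:P uf.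
  have p0 : p = 0.
    apply: horner_dnbhs0; apply: nbhs_dnbhs; move: u0.
    by apply: filterS => z; rewrite -pE hornerX hornerC.
  by have := pE x; rewrite hornerX hornerC p0 horner0.
have u2 x y : y != 0 -> u x y = 0.
  move=> y0; have := form_homogeneous y (x / y) 1 uf.
  by rewrite (mulrC y) divfK // mulr1 u1 mulr0.
move=> x y; have [y0|] := eqVneq y 0; last exact: u2.
have [p pE] := form_polynomial x%:P 'X uf.
have p0 : p = 0.
  apply: horner_dnbhs0; have := nbhs_dnbhs_neq (0 : K); apply: filterS => z z0.
  by rewrite -pE hornerX hornerC u2.
by have := pE y; rewrite hornerX hornerC p0 horner0.
Qed.

Definition proj_point (x y : K) : option K :=
  if y == 0 then None else Some (x / y).

Lemma proj_pointZ c x y : c != 0 -> proj_point (c * x) (c * y) = proj_point x y.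
Proof.
move=> c0; rewrite /proj_point mulf_eq0 (negbTE c0) /=.
by case: eqP => // /eqP y0; congr Some; field; rewrite c0 y0.
Qed.

Lemma proj_point_eq x y x' y' : (x, y) != (0, 0) -> (x', y') != (0, 0) ->
  proj_point x y = proj_point x' y' <-> x * y' = x' * y.
Proof.
rewrite /proj_point !xpair_eqE.
have [->|y0] := eqVneq y 0; have [->|y'0] := eqVneq y' 0;
  rewrite /= ?andbT ?andbF.
- by rewrite !mulr0.
- move=> x0 _; rewrite mulr0; split=> // /eqP.
  by rewrite mulf_eq0 (negbTE x0) (negbTE y'0).
- move=> _ x0; rewrite mulr0; split=> // /esym/eqP.
  by rewrite mulf_eq0 (negbTE x0) (negbTE y0).
move=> _ _; split=> [[]/eqP|/eqP E]; first by rewrite eqr_div // => /eqP.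
by congr Some; apply/eqP; rewrite eqr_div.
Qed.

Lemma proj_point1 z : proj_point z 1 = Some z.
Proof. by rewrite /proj_point oner_eq0 divr1. Qed.

Lemma proj_point_surj (w : option K) :
  exists x y, (x, y) != (0, 0) /\ w = proj_point x y.
Proof.
case: w => [z|]; [exists z, 1|exists 1, 0]; rewrite xpair_eqE oner_eq0 ?andbF //.
  by rewrite proj_point1.
by rewrite /proj_point eqxx.
Qed.

(** These are the rational maps of the sphere; in this presentation, composition
    is substitution and infinity is not an exception. *)
Definition projective (f : option K -> option K) := exists d u v,
  [/\ form d u, form d v,
      forall x y, (x, y) != (0, 0) -> (u x y, v x y) != (0, 0)
    & forall x y, (x, y) != (0, 0) ->
        f (proj_point x y) = proj_point (u x y) (v x y)].

Lemma projective_id : projective id.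
Proof.
exists 1%N, (fun x _ => x), (fun _ y => y).
by split=> //; [exact: form_fst|exact: form_snd].
Qed.

Lemma projective_cst w : projective (fun=> w).
Proof.
have [x [y [xy wE]]] := proj_point_surj w.
by exists 0%N, (fun _ _ => x), (fun _ _ => y); split=> //; exact: form_cst.
Qed.

Lemma projective_comp f g : projective f -> projective g -> projective (f \o g).
Proof.
move=> [d [u [v [uf vf uv fE]]]] [e [r [s [rf sf rs gE]]]].
exists (d * e)%N, (fun x y => u (r x y) (s x y)), (fun x y => v (r x y) (s x y)).
split; [exact: form_comp|exact: form_comp|by move=> x y /rs/uv|].
by move=> x y xy; rewrite /= gE // fE // rs.
Qed.

(** The identity theorem: two such maps agree where the form [u * s - r * v]
    vanishes, and a form that vanishes at the points [(z, 1)] for [z] near 0 is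
    zero. *)
Lemma projective_near_eq f g : projective f -> projective g ->
  (\forall z \near 0, f (Some z) = g (Some z)) -> f = g.
Proof.
move=> [d [u [v [uf vf uv fE]]]] [e [r [s [rf sf rs gE]]]] fg.
pose D x y := u x y * s x y + -1 * (r x y * v x y).
have D0 : forall x y, D x y = 0.
  apply: (@form_eq0 (d + e)%N).
    apply: form_add; first exact: form_mul.
    rewrite -[(d + e)%N]add0n [(d + e)%N]addnC.
    by apply: form_mul; [exact: form_cst|exact: form_mul].
  move: fg; apply: filterS => z; rewrite -proj_point1.
  have z1 : (z, 1) != (0, 0) :> K * K by rewrite xpair_eqE oner_eq0 andbF.
  rewrite fE // gE // => /proj_point_eq E.
  by rewrite /D E ?uv ?rs // mulN1r subrr.
apply/funext => w; have [x [y [xy ->]]] := proj_point_surj w.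
rewrite fE // gE //; apply/proj_point_eq; [exact: uv|exact: rs|].
by have /eqP := D0 x y; rewrite /D mulN1r subr_eq0 => /eqP.
Qed.

Definition germ_of (f : option K -> option K) (F : K -> K) :=
  [/\ regular F, F 0 = 0 & \forall z \near 0, f (Some z) = Some (F z)].

Lemma germ_of_id : germ_of id id.
Proof. by split=> //; [exact: regular_id|exact: filterE]. Qed.

Lemma germ_of_comp f g F G :
  germ_of f F -> germ_of g G -> germ_of (f \o g) (F \o G).
Proof.
move=> [F_reg F0 fF] [G_reg G0 gG]; split; first exact: regular_comp.
  by rewrite /= G0.
by move: gG (near_comp G_reg G0 fF); apply: filterS2 => z /= ->.
Qed.

Lemma germ_of_unique f F G : germ_of f F -> germ_of f G -> germ_eq F G.
Proof.
by move=> [_ _ fF] [_ _ fG]; move: fF fG; apply: filterS2 => z -> [].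
Qed.

Lemma germ_of_inj f g F G : projective f -> projective g ->
  germ_of f F -> germ_of g G -> germ_eq F G -> f = g.
Proof.
move=> f_proj g_proj [_ _ fF] [_ _ gG] FG; apply: projective_near_eq => //.
by move: fF gG FG; apply: filterS3 => z -> -> ->.
Qed.

Lemma projective_germ f :
  projective f -> f (Some 0) = Some 0 -> exists F, germ_of f F.
Proof.
move=> [d [u [v [uf vf uv fE]]]].
have z1 z : (z, 1) != (0, 0) :> K * K by rewrite xpair_eqE oner_eq0 andbF.
have [p pE] := form_polynomial 'X 1%:P uf.
have [q qE] := form_polynomial 'X 1%:P vf.
have fpq z : f (Some z) = proj_point p.[z] q.[z].
  by rewrite -[Some z]proj_point1 fE // -pE -qE !hornerX !hornerC.
rewrite fpq /proj_point; case: eqP => // /eqP q0 [pq0].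
exists (fun z => p.[z] / q.[z]); split=> //.
  apply: regularM; first exact: regular_horner.
  by apply: regularV => //; exact: regular_horner.
have := horner_near_neq0 q0; apply: filterS => z qz.
by rewrite fpq /proj_point (negbTE qz).
Qed.
End Forms.

Section Sphere.
Local Open Scope ring_scope.
Variable R : realType.
Local Notation C := R[i].
Implicit Types (f g : selfmap (Cbar R)) (w : Cbar R).

Lemma fraction_form (d : nat) (p : {poly C}) : (size p <= d.+1)%N ->
  exists u, [/\ form d u, forall z, u z 1 = p.[z] & u 1 0 = p`_d].
Proof.
move=> sp; exists (fun x y => \sum_(i < d.+1) p`_i * x ^+ i * y ^+ (d - i)).
split=> [|z|].
- suff : forall n, (n <= d.+1)%N ->
      form d (fun x y : C => \sum_(i < n) p`_i * x ^+ i * y ^+ (d - i)).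
    by apply.
  elim=> [_|n IH nd].
    under eq_fun do under eq_fun do rewrite big_ord0.
    have := form_monomial (0 : C) 0 d; rewrite add0n.
    by under eq_fun do under eq_fun do rewrite !mul0r.
  under eq_fun do under eq_fun do rewrite big_ord_recr /=.
  apply: form_add; first exact/IH/ltnW.
  by have := form_monomial p`_n n (d - n); rewrite subnKC.
- rewrite (horner_coef_wide _ sp); apply: eq_bigr => i _.
  by rewrite expr1n mulr1.
rewrite big_ord_recr /= subnn expr1n expr0 !mulr1 big1 ?add0r // => i _.
by rewrite expr0n subn_eq0 leqNgt ltn_ord mulr0.
Qed.

Lemma fraction_degree_coef (p q : {poly C}) (d := fraction_degree p q) :
  coprimep p q -> (p`_d != 0) || (q`_d != 0).
Proof.
have top (r : {poly C}) : r != 0 -> r`_(size r).-1 != 0.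
  by rewrite -[r`_ _]lead_coefE lead_coef_eq0.
have [p0|p0] := eqVneq p 0; have [q0|q0] := eqVneq q 0 => pq.
- by move: pq; rewrite p0 q0 coprimep0 -size_poly_eq1 size_poly0.
- have -> : d = (size q).-1 by rewrite /d /fraction_degree p0 size_poly0 max0n.
  by rewrite (top q q0) orbT.
- have -> : d = (size p).-1 by rewrite /d /fraction_degree q0 size_poly0 maxn0.
  by rewrite (top p p0).
have [spq|/ltnW sqp] := leqP (size p) (size q).
  have -> : d = (size q).-1 by rewrite /d /fraction_degree (maxn_idPr spq).
  by rewrite (top q q0) orbT.
have -> : d = (size p).-1 by rewrite /d /fraction_degree (maxn_idPl sqp).
by rewrite (top p p0).
Qed.

Lemma fraction_map_projective (p q : {poly C}) :
  coprimep p q -> projective (fraction_map p q).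
Proof.
move=> pq; pose d := fraction_degree p q.
have sp : (size p <= d.+1)%N.
  by rewrite (leq_trans _ (leqSpred _)) // leq_maxl.
have sq : (size q <= d.+1)%N.
  by rewrite (leq_trans _ (leqSpred _)) // leq_maxr.
have [u [uf u1 u0]] := fraction_form sp.
have [v [vf v1 v0]] := fraction_form sq.
have pqd : (p`_d, q`_d) != (0, 0).
  by rewrite xpair_eqE negb_and; exact: fraction_degree_coef.
have norm x y : (x, y) != (0, 0) ->
    exists c x' y', [/\ c != 0, x = c * x', y = c * y' &
      (x' = 1 /\ y' = 0) \/ y' = 1 :> C].
  rewrite xpair_eqE => xy; have [y0|y0] := eqVneq y 0.
    exists x, 1, 0; move: xy; rewrite y0 eqxx andbT mulr1 mulr0.
    by split=> //; left.
  exists y, (x / y), 1; rewrite (mulrC y) divfK // mulr1.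
  by split; [exact: y0|by []|by []|right].
exists d, u, v; split=> // x y /norm[c [x' [y' [c0 -> -> xy']]]].
  rewrite !(form_homogeneous _ _ _ uf, form_homogeneous _ _ _ vf).
  rewrite xpair_eqE !mulf_eq0 !expf_eq0 (negbTE c0) !andbF /= -xpair_eqE.
  case: xy' => [[-> ->]|->]; first by rewrite u0 v0.
  rewrite u1 v1 xpair_eqE; apply/negP => /andP[px qx].
  by have := coprimep_root pq px; rewrite qx.
rewrite (form_homogeneous _ _ _ uf) (form_homogeneous _ _ _ vf).
rewrite !proj_pointZ ?expf_neq0 //.
case: xy' => [[-> ->]|->]; last by rewrite proj_point1 u1 v1.
by rewrite u0 v0 /proj_point eqxx.
Qed.

Lemma noninjective_projective f : noninjective_rational_map f -> projective f.
Proof. by move=> [d _ [p [q [pq _ ->]]]]; exact: fraction_map_projective. Qed.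

(** If [p / q] is constant, then [q] divides [p] or is zero, and coprimality
    makes both constant. *)
Lemma noninjective_not_cst f w : noninjective_rational_map f -> f <> fun=> w.
Proof.
move=> [d d2 [p [q [pq dE ->]]]] fw.
have fz (z : C) : (if q.[z] == 0 then None else Some (p.[z] / q.[z])) = w.
  by have := congr1 (fun h => h (Some z)) fw.
have poly0 (r : {poly C}) : (forall z, r.[z] = 0) -> r = 0.
  by move=> r0; apply: horner_dnbhs0; exact: filterE.
suff pq1 : (maxn (size p) (size q) <= 1)%N.
  by move: d2; rewrite -dE /fraction_degree ltnNge -ltnS
    (leq_trans (leqSpred _)) ?ltnS //;
    case: maxn pq1 => [|[]].
case: w fw fz => [c|] _ fz.
  have pE : p = c *: q.
    apply/eqP; rewrite -subr_eq0; apply/eqP/poly0 => z.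
    have := fz z; case: eqP => // /eqP qz [<-].
    by rewrite hornerD hornerN hornerZ divfK // subrr.
  have q1 : (size q <= 1)%N.
    have := pq; rewrite coprimep_sym /coprimep pE.
    have /eqp_size -> : gcdp q (c *: q) %= q.
      by apply: dvdp_gcd_idl; rewrite -mul_polyC dvdp_mull.
    by move=> /eqP ->.
  by rewrite geq_max q1 andbT (leq_trans _ q1) // pE size_scale_leq.
have q0 : q = 0.
  by apply: poly0 => z; have := fz z; case: eqP.
have := pq; rewrite q0 coprimep0 -size_poly_eq1 => /eqP ->.
by rewrite size_poly0.
Qed.
End Sphere.

(** * Superattracting fixed points *)

Section Charts.
Local Open Scope ring_scope.
Variable R : realType.
Local Notation C := R[i].
Implicit Types (f g : selfmap (Cbar R)) (w : Cbar R).

(** Coordinates in which [w] is the point 0. *)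
Definition chart w : selfmap (Cbar R) :=
  if w is Some a then omap (fun z => z + a) else @inv_Cbar R.

Definition chart_inv w : selfmap (Cbar R) :=
  if w is Some a then omap (fun z => z - a) else @inv_Cbar R.

Lemma inv_CbarK : involutive (@inv_Cbar R).
Proof.
case=> [z|] /=; last by rewrite eqxx.
by have [->//|z0] := eqVneq z 0; rewrite /= invr_eq0 (negbTE z0) invrK.
Qed.

Lemma chartK w : cancel (chart w) (chart_inv w).
Proof.
case: w => [a|]; last exact: inv_CbarK.
by case=> [z|] //=; rewrite addrK.
Qed.

Lemma chart_invK w : cancel (chart_inv w) (chart w).
Proof.
case: w => [a|]; last exact: inv_CbarK.
by case=> [z|] //=; rewrite subrK.
Qed.

Lemma chart0 w : chart w (Some 0) = w.
Proof. by case: w => [a|] /=; rewrite ?add0r ?eqxx. Qed.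

Lemma projective_translation (a : C) : projective (omap (fun z => z + a)).
Proof.
exists 1%N, (fun x y => x + a * y), (fun _ y => y); split.
- apply: form_add; first exact: form_fst.
  exact: (form_mul (form_cst a) (form_snd _)).
- exact: form_snd.
- move=> x y; rewrite !xpair_eqE; have [->|] := eqVneq y 0.
    by rewrite mulr0 addr0.
  by rewrite !andbF.
move=> x y _; rewrite /proj_point; have [//|y0] := eqVneq y 0.
by rewrite /= mulrDl mulfK.
Qed.

Lemma projective_inv : projective (@inv_Cbar R).
Proof.
exists 1%N, (fun _ y => y), (fun x _ => x); split.
- exact: form_snd.
- exact: form_fst.
- by move=> x y; rewrite !xpair_eqE andbC.
move=> x y; rewrite xpair_eqE /proj_point; have [->|y0] := eqVneq y 0.
  by rewrite andbT => /negbTE x0; rewrite x0 /= mul0r.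
move=> _ /=; rewrite mulf_eq0 invr_eq0 (negbTE y0) orbF.
by have [//|x0] := eqVneq x 0; rewrite invf_div.
Qed.

Lemma projective_chart w : projective (chart w).
Proof.
by case: w => [a|]; [exact: projective_translation|exact: projective_inv].
Qed.

Lemma projective_chart_inv w : projective (chart_inv w).
Proof.
by case: w => [a|]; [exact: projective_translation|exact: projective_inv].
Qed.

Definition in_chart w f : selfmap (Cbar R) := chart_inv w \o f \o chart w.

Lemma in_chart_comp w f g : in_chart w (f \o g) = in_chart w f \o in_chart w g.
Proof. by apply/funext => x; rewrite /in_chart /= chart_invK. Qed.

Lemma in_chart_id w : in_chart w id = id.
Proof. by apply/funext => x; rewrite /in_chart /= chartK. Qed.

Lemma in_chart_inj w : injective (in_chart w).
Proof.
move=> f g fg; apply/funext => x;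
have := congr1 (fun h => h (chart_inv w x)) fg.
by rewrite /in_chart /= chart_invK => /(can_inj (chart_invK w)).
Qed.

Lemma projective_in_chart w f : projective f -> projective (in_chart w f).
Proof.
move=> f_proj; apply: projective_comp (projective_chart w).
exact: projective_comp (projective_chart_inv w) f_proj.
Qed.

Lemma local_map_germ w f F : germ_of (in_chart w f) F ->
  \forall z \near (0 : (C : numFieldType)),
    local_map f w (z + odflt (0 : C) w) = F z + odflt (0 : C) w.
Proof.
move=> [_ _]; apply: filterS => z; case: w => [a|] /= fF; last first.
  by rewrite !addr0 /local_map /= fF.
by have := congr1 (chart (Some a)) fF; rewrite chart_invK /local_map /= => ->.
Qed.

(** The order of the germ at the fixed point is finite because the map is not
    constant, and is not 1 because the derivative vanishes. *)
Lemma superattracting_leading w f :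
    noninjective_rational_map f -> superattracting_fixed_point f w ->
  exists F a n, [/\ germ_of (in_chart w f) F, leading F a n & (1 < n)%N].
Proof.
move=> f_rat [fw [fd f'0]].
have f_proj := noninjective_projective f_rat.
have [|F fF] := projective_germ (projective_in_chart w f_proj).
  by rewrite /in_chart /= chart0 fw -{2}(chart0 w) chartK.
have [F_reg F0 _] := fF.
have [F00|[a [n Fl]]] := regular_leading F_reg.
  have cst0 : germ_of (fun=> Some (0 : C)) (fun=> 0).
    by split=> //; [exact: regular_cst|exact: filterE].
  have := germ_of_inj (projective_in_chart w f_proj) (projective_cst _)
    fF cst0 F00.
  move=> fc; exfalso; apply: (@noninjective_not_cst R f w f_rat).
  apply/funext => x; have := congr1 (fun h => chart w (h (chart_inv w x))) fc.
  by rewrite /in_chart /= !chart_invK chart0.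
exists F, a, n; split=> //.
have [U [U_reg U0 a0 FU]] := Fl.
case: n Fl FU => [|[|n]] // Fl FU.
  by move: a0; rewrite -U0 -[U 0]mul1r -(expr0 0) -(germ_eq0 FU) F0 eqxx.
exfalso; move/negP: a0; apply; apply/eqP.
pose q (h : C^o) : C^o := h^-1 *:
  ((local_map f w \o shift (odflt (0 : C) w : C^o)) (h *: (1 : C^o)) -
   local_map f w (odflt (0 : C) w)).
have q0 := fd.
rewrite /derivable -[lim _]/('D_(1 : C^o) (local_map f w) _) f'0 in q0.
have UU : U h @[h --> (0 : C^o)] --> (U 0 : C^o) := regular_cvg U_reg.
have qU : q h @[h --> (0 : C^o)^'] --> (U 0 : C^o).
  apply: cvg_trans (cvg_trans (cvg_app U (@nbhs_dnbhs C^o 0)) UU).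
  apply: near_eq_cvg.
  have FU' : \forall h \near (0 : C^o)^', F h = h ^+ 1 * U h := nbhs_dnbhs FU.
  have fF' : \forall h \near (0 : C^o)^', local_map f w (h + odflt (0 : C) w) =
    F h + odflt (0 : C) w := nbhs_dnbhs (local_map_germ fF).
  have f0 : local_map f w (odflt (0 : C) w) = odflt (0 : C) w.
    by have := nbhs_singleton (local_map_germ fF); rewrite F0 !add0r.
  have := nbhs_dnbhs_neq (0 : C^o); move: FU' fF'; apply: filterS3 => h Fh fh h0.
  rewrite /q /= -[h *: _]/(h * 1) mulr1 fh f0 addrK Fh expr1.
  by rewrite -[_ *: _]/(h^-1 * (h * U h)) mulKf.
rewrite -U0; apply/esym.
exact: (cvg_unique (@norm_hausdorff C C^o) q0 qU).
Qed.
End Charts.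

(** * The three cases *)

Section Cases.
Local Open Scope ring_scope.
Variable R : realType.
Local Notation C := R[i].

Lemma subsemigroup_cancellative (T : semigroupType) (A : subsemigroup T) :
  cancellative T -> cancellative A.
Proof.
apply: (@cancellative_injective A T val); last exact: val_inj.
by move=> x y.
Qed.

Lemma subsemigroup_elt (T : semigroupType) (A : subsemigroup T) (x : T) :
  (A : set T) x -> exists h : A, val h = x.
Proof. by move=> /mem_set Ax; exists (exist _ x Ax). Qed.

Lemma subsemigroup_inhabited (T : semigroupType) (A : subsemigroup T) :
  exists x : A, True.
Proof. by have [x /subsemigroup_elt[h _]] := subsemigroup_neq0 A; exists h. Qed.

Lemma monomial_map_inj (l m : C) (n k : nat) : l != 0 ->
  monomial_map l n = monomial_map m k -> l = m /\ n = k.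
Proof.
move=> l0 lm; have lmz (z : C) : l * z ^+ n = m * z ^+ k.
  by have [] := congr1 (fun h => h (Some z)) lm.
have lmE : l = m by have := lmz 1; rewrite !expr1n !mulr1.
split=> //; have := lmz 2; rewrite -lmE => /(mulfI l0)/eqP.
by rewrite -!natrX eqr_nat eqn_exp2l // => /eqP.
Qed.

Lemma MP_embeddable (H : subsemigroup (MP R)) :
  cancellative H -> embeddable_in_group H.
Proof.
move=> H_can; have [t0 _] := subsemigroup_inhabited H.
have repr (h : H) : exists ln : C * nat,
    [/\ ln.1 != 0, (0 < ln.2)%N & val (val h) = monomial_map ln.1 ln.2].
  by have /set_mem [l [n [l0 n0 hE]]] := valP (val h); exists (l, n).
have [r rE] := choice repr.
have rM s t :
    r (s * t)%g = ((r s).1 * (r t).1 ^+ (r s).2, ((r s).2 * (r t).2)%N).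
  have [_ _ stE] := rE (s * t)%g; have [_ _ sE] := rE s; have [_ _ tE] := rE t.
  have [] := @monomial_map_inj (r (s * t)%g).1 ((r s).1 * (r t).1 ^+ (r s).2)
    (r (s * t)%g).2 ((r s).2 * (r t).2)%N.
  - by have [] := rE (s * t)%g.
  - rewrite -stE -[val (val _)]/(selfmap_mul (val (val s)) (val (val t))) sE tE.
    apply/funext => -[z|//]; congr Some.
    by rewrite exprMn mulrA -exprM mulnC.
  by case: (r _) => l n /= -> ->.
apply: (@embeddable_monomials C H t0 (fun h => (r h).1) (fun h => (r h).2)) => //.
- by move=> s; have [] := rE s.
- by move=> s; have [] := rE s.
- by move=> s t; rewrite rM.
- by move=> s t; rewrite rM.
move=> s t st1 st2; do 2! apply: val_inj.
by have [_ _ ->] := rE s; have [_ _ ->] := rE t; rewrite st1 st2.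
Qed.

Section Generated.
Variables (P Q : selfmap (Cbar R)).
Definition generator (b : bool) : Cbar R -> Cbar R := if b then Q else P.

Lemma generated2_run f :
  generated2_set P Q f <-> exists2 w, w != [::] & f = run generator w.
Proof.
split=> [f_gen|[w w0 ->] A [AM AP]].
  apply: (f_gen [set h | exists2 w, w != [::] & h = run generator w]).
  split=> [_ _ [u u0 ->] [v v0 ->]|_ [->|->]].
  - exists (u ++ v); first by case: u u0.
    by rewrite run_cat.
  - by exists [:: false].
  - by exists [:: true].
elim: w w0 => // b w IH _.
have Ab : A (generator b) by apply: AP; case: b; [right|left].
case: w IH => [//|c w] IH; exact: AM Ab (IH isT).
Qed.

Lemma run_cancel (u v : seq bool) b : cancellative (generated2 P Q) ->
  u != [::] -> v != [::] ->
  run generator u \o generator b = run generator v \o generator b ->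
  run generator u = run generator v.
Proof.
move=> can u0 v0 uv.
have elt w : w != [::] ->
    exists h : generated2 P Q, val h = run generator w.
  by move=> w0; apply: subsemigroup_elt; apply/generated2_run; exists w.
have [hb hbE] := elt [:: b] isT; have [hu huE] := elt u u0.
have [hv hvE] := elt v v0; rewrite -huE -hvE; congr (val _).
apply: (can hb hu hv).2; apply: val_inj.
rewrite -[LHS]/(selfmap_mul (val hu) (val hb)).
by rewrite -[RHS]/(selfmap_mul (val hv) (val hb)) huE hvE hbE.
Qed.
End Generated.

(** Without a relation between [P] and [Q] they generate a free semigroup. A
    relation can be shortened on the right until its last letters differ; then
    the leading terms at the fixed point identify the semigroup with a
    semigroup of monomials. *)
Lemma superattracting_embeddable (P Q : selfmap (Cbar R)) (z0 : Cbar R) :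
    noninjective_rational_map P -> noninjective_rational_map Q ->
    superattracting_fixed_point P z0 -> superattracting_fixed_point Q z0 ->
  cancellative (generated2 P Q) -> embeddable_in_group (generated2 P Q).
Proof.
move=> P_rat Q_rat P_fix Q_fix can.
pose g := generator P Q.
have gens b : exists Fan : (C -> C) * C * nat,
    [/\ germ_of (in_chart z0 (g b)) Fan.1.1, leading Fan.1.1 Fan.1.2 Fan.2
      & (1 < Fan.2)%N].
  by case: b; [have [F [a [n FE]]] := superattracting_leading Q_rat Q_fix
              |have [F [a [n FE]]] := superattracting_leading P_rat P_fix];
    exists (F, a, n).
have [r /all_and3[gF Fl n1]] := choice gens.
pose F b := (r b).1.1; pose ord := word_order (fun b => (r b).2).
have g_proj b : projective (g b) by case: b; exact: noninjective_projective.
have run_proj w : projective (run g w).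
  elim: w => [|b w IH]; first exact: projective_id.
  exact: projective_comp (g_proj b) IH.
have run_germ w : germ_of (in_chart z0 (run g w)) (run F w).
  elim: w => [|b w IH]; first by rewrite in_chart_id; exact: germ_of_id.
  rewrite [run g _]/= in_chart_comp; exact: germ_of_comp (gF b) IH.
have run_eq u v : run g u = run g v <-> germ_eq (run F u) (run F v).
  split=> [uv|uv].
    by apply: germ_of_unique (run_germ u) _; rewrite uv; exact: run_germ.
  apply: (@in_chart_inj _ z0); apply: germ_of_inj uv => //.
  - exact: projective_in_chart.
  - exact: projective_in_chart.
have run_lead w : exists c, leading (run F w) c (ord w) := run_leading Fl n1 w.
have run_ord u v : run g u = run g v -> ord u = ord v.
  move=> /run_eq uv; have [[c ul] [d vl]] := (run_lead u, run_lead v).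
  by have [_] := leading_unique (leading_eq uv ul) vl.
have ord1 w : ord w = 1%N -> w = [::].
  case: w => // b w /eqP; rewrite /= muln_eq1 => /andP[/eqP E _].
  by have := n1 b; rewrite E.
have ord_rcons w b : ord (rcons w b) = (ord w * (r b).2)%N
  by exact: word_order_rcons.
have words (h : generated2 P Q) : exists w, w != [::] /\ val h = run g w.
  by have /set_mem/generated2_run[w w0 hE] := valP h; exists w.
have [word /all_and2[word0 wordE]] := choice words.
have wordM s t : run g (word (s * t)%g) = run g (word s ++ word t).
  by rewrite run_cat -!wordE.
have [run_inj|] := pselect (forall u v, run g u = run g v -> u = v).
  apply: (@embeddable_free2 _ word) => [s t|s t st]; first exact: run_inj.
  by apply: val_inj; rewrite !wordE st.
move=> /existsNP[u /existsNP[v /not_implyP[uv uv_neq]]].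
have [A [B AB]] : exists A B, run g (rcons A true) = run g (rcons B false).
  elim/last_ind: u v uv uv_neq => [|u b IH] v uv uv_neq.
    by case: uv_neq; rewrite (ord1 v) // -(run_ord _ _ uv).
  case/lastP: v uv uv_neq => [|v c] uv uv_neq.
    by case: uv_neq; apply: ord1; rewrite (run_ord _ _ uv).
  have [bc|] := eqVneq b c; last first.
    by case: b c uv {uv_neq} => [] [] //= uv _; [exists u, v|exists v, u].
  subst c; have ord_uv : ord u = ord v.
    have := run_ord _ _ uv; rewrite !ord_rcons => /eqP.
    by rewrite eqn_pmul2r ?(ltnW (n1 b)) // => /eqP.
  have [u0|u0] := eqVneq u [::].
    by case: uv_neq; rewrite u0 (ord1 v) // -ord_uv u0.
  have [v0|v0] := eqVneq v [::].
    by case: uv_neq; rewrite v0 (ord1 u) // ord_uv v0.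
  apply: (IH v); last by move=> E; case: uv_neq; rewrite E.
  apply: (run_cancel can u0 v0 (b := b)).
  by move: uv; rewrite -!cats1 !run_cat.
have [coef coefE] := choice (fun h => run_lead (word h)).
have [t0 _] := subsemigroup_inhabited (generated2 P Q).
have prod_lead s t :
    coef (s * t)%g = coef s * coef t ^+ ord (word s) /\
    ord (word (s * t)%g) = (ord (word s) * ord (word t))%N.
  apply: leading_unique (coefE _) _.
  have /run_eq/germ_eq_sym E := wordM s t; apply: leading_eq E _.
  rewrite run_cat; apply: leading_comp => //.
  exact: (word_order_gt0 n1).
apply: (@embeddable_monomials C _ t0 coef (fun h => ord (word h))) => //.
- by move=> s; have [U []] := coefE s.
- by move=> s; exact: (word_order_gt0 n1).
- by move=> s t; have [] := prod_lead s t.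
- by move=> s t; have [] := prod_lead s t.
move=> s t st ord_st; apply: val_inj; rewrite !wordE; apply/run_eq.
have sl := coefE s; have tl := coefE t; rewrite -st -ord_st in tl.
apply: (leading_determines_word Fl n1 _ sl tl).
by move: AB => /run_eq; exact.
Qed.

End Cases.

Theorem theorem12 (R : realType) (S : subsemigroup (selfmap (Cbar R)))
    (S_rational : S `<=` @rational_map R) (S_cancellative : cancellative S) :
  [\/ exists H : subsemigroup (MP R), isomorphic S H,
      exists (P Q : selfmap (Cbar R)) (z0 : Cbar R),
        [/\ noninjective_rational_map P, noninjective_rational_map Q,
            superattracting_fixed_point P z0, superattracting_fixed_point Q z0
          & isomorphic S (generated2 P Q)]
    | exists (I : choiceType) (A : I -> subsemigroup S),
        (forall i, right_amenable R (A i)) /\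
        isomorphic S (free_product (fun i => A i))] ->
  embeddable_in_group S.
Proof.
case=> [[H SH]|[P [Q [z0 [P_rat Q_rat P_fix Q_fix SPQ]]]]|[I [A [A_am SA]]]].
- apply: (isomorphic_embeddable SH); apply: MP_embeddable.
  exact: isomorphic_cancellative SH S_cancellative.
- apply: (isomorphic_embeddable SPQ).
  apply: superattracting_embeddable P_rat Q_rat P_fix Q_fix _.
  exact: isomorphic_cancellative SPQ S_cancellative.
apply: (isomorphic_embeddable SA); apply: embeddable_free_product.
  exact: isomorphic_cancellative SA S_cancellative.
move=> i; apply: embeddable_common_multiple.
  exact: subsemigroup_cancellative.
exact: right_amenable_common_multiple (A_am i).
Qed.
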